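(* $\textnormal{ASI}_c(1)\subseteq\textnormal{HComp}$. That is, if a coloring problem $(\Pi,\Gamma)$ is solved by some computable ASI-1 algorithm, then every highly computable structured graph $G\in\Gamma$ admits a computable $\Pi$-coloring.
   Context: All graphs are locally finite. HF denotes the set of hereditarily finite sets. A structured graph is a structure in a finite language extending the language of graphs (one binary adjacency relation, interpreted symmetrically and irreflexively). A coloring problem $(\Pi,\Gamma)$ consists of a class $\Gamma$ of structured graphs, closed under isomorphism and such that $G\in\Gamma$ iff every connected component of $G$ is in $\Gamma$, and a class $\Pi$ of functions $V(G)\to\textnormal{HF}$ ($G\in\Gamma$) (called $\Pi$-colorings), closed under pushforward by isomorphisms and such that $c\in\Pi$ iff its restriction to each component is in $\Pi$. An ASI-$s$ algorithm is a function $\mathcal{A}$ which, on input $(H,<,U_0,\dots,U_s,C)$ where $H$ is a finite structured graph, $<$ a linear order on $V(H)$, $U_0,\dots,U_s$ a partition of $V(H)$, and $C\subseteq V(H)$, returns a function $C\to\textnormal{HF}$, such that for any isomorphism $\phi$ of such input structures, $\mathcal{A}(\text{input})=\mathcal{A}(\phi(\text{input}))\circ(\phi\upharpoonright C)$. It is computable if it is computable as a function on (canonical HF codes of) its inputs. For a structured graph $G$ with path metric $\rho_G$ and $r\in\omega$, $G^r$ is the graph on $V(G)$ joining distinct $x,y$ with $\rho_G(x,y)\le r$. An ASI-$s$ witness for $G$ with scale $r$ is a partition $U_0,\dots,U_s$ of $V(G)$ such that every connected component of each $G^r\upharpoonright U_i$ is finite. Given such a witness and a linear order $<$ on $V(G)$,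 let $\mathcal{C}$ be the disjoint set of all components of all $G^r\upharpoonright U_i$, and $\tilde G$ the graph on $\mathcal{C}$ joining $C\neq D$ when $\rho_G(C,D)\le r$. For $n\in\omega$, $\mathcal{A}_n[(G,<,U_0,\dots,U_s)]$ colors each $C\in\mathcal{C}$ by $\mathcal{A}(G\upharpoonright W,<\upharpoonright W,U_0\cap W,\dots,U_s\cap W,C)$, where $W=\bigcup\{D\in\mathcal{C}:\rho_{\tilde G}(C,D)\le n\}$. $(\Pi,\Gamma)\in\textnormal{ASI}_c(s)$ if there are a computable ASI-$s$ algorithm $\mathcal{A}$ and $n,r\in\omega$ such that for every $G\in\Gamma$, every linear order $<$ on $V(G)$ and every ASI-$s$ witness for $G$ with scale $r$, $\mathcal{A}_n[(G,<,U_0,\dots,U_s)]\in\Pi$. A structured graph is highly computable if $V(G)$ is a computable subset of HF, all its relations are computable, and $x\mapsto\deg_G(x)$ is computable. A coloring is computable if it is computable as a function. $(\Pi,\Gamma)\in\textnormal{HComp}$ if every highly computable $G\in\Gamma$ admits a computable $\Pi$-coloring. *)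

(* Defs.v *)
From mathcomp Require Import all_boot.
From mathcomp Require Import finmap.
From mathcomp Require Import boolp classical_sets functions cardinality fsbigop.

Set Implicit Arguments.
Unset Strict Implicit.
Unset Printing Implicit Defensive.

Local Open Scope classical_set_scope.
Local Open Scope card_scope.
Local Open Scope nat_scope.

(** HF is represented by its Ackermann coding: the number [n] is the set of
    the positions of the nonzero binary digits of [n].  [hf_set_mem] and
    [hf_mem_set] say that this identifies [nat] with its own finite subsets. *)

Definition HF := nat.

Definition hf_mem (x y : HF) : bool := odd (y %/ 2 ^ x).

(** For an infinite [A] the value is the junk value 0. *)
Definition hf_set (A : set HF) : HF := \big[addn/0]_(x \in A) 2 ^ x.

(** Kuratowski pairs. *)
Definition hf_pair (x y : HF) : HF :=
  hf_set [set hf_set [set x]; hf_set [set x; y]].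

Definition hf_list (s : seq HF) : HF := foldr hf_pair (hf_set set0) s.

Lemma sum_pow2 k : \sum_(i < k) 2 ^ i = (2 ^ k).-1.
Proof.
elim: k => [|k IH]; first by rewrite big_ord0.
rewrite big_ord_recr /= IH expnS mul2n -addnn.
by case: (2 ^ k) (expn_gt0 2 k).
Qed.

Lemma hf_mem_set (A : set HF) x : finite_set A -> hf_mem x (hf_set A) <-> A x.
Proof.
move=> fA; rewrite /hf_mem /hf_set fsbig_finite //=.
set s := fset_set A.
have sA y : y \in enum_fset s <-> A y.
  have : (y \in s) = (y \in A) by rewrite in_fset_set.
  by move=> E; rewrite -[y \in _]/(y \in s) E inE.
have us : uniq (enum_fset s) by apply: fset_uniq.
rewrite -sA; move: (enum_fset s) us => {sA} {}s us.
have lo : \sum_(y <- s | y < x) 2 ^ y < 2 ^ x.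
  have -> : 2 ^ x = (\sum_(i < x) 2 ^ i).+1.
    by rewrite sum_pow2 prednK // expn_gt0.
  rewrite ltnS -(big_mkord xpredT (fun i => 2 ^ i)) -big_filter.
  apply: (@sub_le_big_seq _ addn leq) => //.
  - by move=> a b; apply: leq_addr.
  - move=> y; rewrite count_uniq_mem ?filter_uniq // count_uniq_mem ?iota_uniq //.
    by rewrite mem_filter mem_index_iota /=; case: (y < x) => //=; case: (y \in s).
have hi : 2 ^ x.+1 %| \sum_(y <- s | x < y) 2 ^ y.
  by apply: dvdn_sum => y xy; apply: dvdn_exp2l.
have mid : \sum_(y <- s | y == x) 2 ^ y = (x \in s) * 2 ^ x.
  rewrite (eq_bigr (fun=> 2 ^ x)); last by move=> y /eqP ->.
  by rewrite big_const_seq iter_addn_0 mulnC -(count_uniq_mem x us).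
have -> : \sum_(y <- s) 2 ^ y = (((x \in s) +
    2 * ((\sum_(y <- s | x < y) 2 ^ y) %/ 2 ^ x.+1)) * 2 ^ x)
    + \sum_(y <- s | y < x) 2 ^ y.
  rewrite mulnDl -mid mulnAC -expnS mulnC divnK //.
  rewrite (bigID (fun y => y < x)) /= addnC; congr (_ + _).
  rewrite (bigID (fun y => y == x)) /=; congr (_ + _); apply: eq_bigl => y;
    by case: (ltngtP y x).
rewrite divnMDl ?expn_gt0 // (divn_small lo) addn0 oddD oddM /= addbF.
by case: (x \in s).
Qed.

Lemma hf_set_mem (n : HF) : hf_set [set x | hf_mem x n] = n.
Proof.
have small x : n <= x -> hf_mem x n = false.
  move=> nx; rewrite /hf_mem divn_small //.
  by apply: leq_ltn_trans nx _; apply: ltn_expl.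
have dig k : \sum_(0 <= x < k) (if hf_mem x n then 2 ^ x else 0) = n %% 2 ^ k.
  elim: k => [|k IH]; first by rewrite big_geq // modn1.
  rewrite big_nat_recr //= IH.
  have e : n = (n %/ 2 ^ k)./2 * 2 ^ k.+1 +
               ((if hf_mem k n then 2 ^ k else 0) + n %% 2 ^ k).
    have -> : (if hf_mem k n then 2 ^ k else 0) = hf_mem k n * 2 ^ k.
      by case: hf_mem; rewrite ?mul1n.
    rewrite expnS mulnA muln2 addnA -mulnDl addnC [_ + hf_mem _ _]addnC.
    by rewrite /hf_mem odd_double_half addnC -divn_eq.
  have lt : (if hf_mem k n then 2 ^ k else 0) + n %% 2 ^ k < 2 ^ k.+1.
    rewrite expnS mul2n -addnn; case: ifP => _.
      by rewrite ltn_add2l ltn_mod expn_gt0.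
    by rewrite add0n ltn_addl // ltn_mod expn_gt0.
  by rewrite [in RHS]e modnMDl (modn_small lt) addnC.
have fin : finite_set [set x | hf_mem x n].
  apply: (sub_finite_set _ (finite_II n)) => x /= h.
  by rewrite ltnNge; apply/negP => /small; rewrite h.
rewrite /hf_set fsbig_mkcond.
have -> : \big[addn/0]_(x \in [set: nat]) patch (fun=> 0) [set x | hf_mem x n]
    (fun x => 2 ^ x) x = \big[addn/0]_(x \in `I_n)
    (if hf_mem x n then 2 ^ x else 0).
  rewrite [RHS]fsbig_mkcond; apply: eq_fsbigr => x _; rewrite /patch.
  have -> : (x \in [set x | hf_mem x n]) = hf_mem x n by apply/idP/idP; rewrite inE.
  have -> : (x \in `I_n) = (x < n) by apply/idP/idP; rewrite inE.
  by case: (leqP n x) => // /small ->.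
by rewrite -fsbig_ord -(big_mkord xpredT (fun x => if hf_mem x n then 2 ^ x else 0))
  dig modn_small // ltn_expl.
Qed.

Inductive recf : nat -> Type :=
| Zero n : recf n
| Succ : recf 1
| Proj n : 'I_n -> recf n
| Comp m n : recf m -> ('I_m -> recf n) -> recf n
| Prim n : recf n -> recf n.+2 -> recf n.+1
| Mu n : recf n.+1 -> recf n.

(** [eval p t y]: the program [p] halts on the arguments [t] with value [y]. *)
Inductive eval : forall n, recf n -> n.-tuple nat -> nat -> Prop :=
| eval_Zero n (t : n.-tuple nat) : eval (Zero n) t 0
| eval_Succ x : eval Succ [tuple x] x.+1
| eval_Proj n (i : 'I_n) t : eval (Proj i) t (tnth t i)
| eval_Comp m n (f : recf m) (g : 'I_m -> recf n) t (u : m.-tuple nat) y :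
    (forall i, eval (g i) t (tnth u i)) -> eval f u y -> eval (Comp f g) t y
| eval_Prim0 n (f : recf n) g t y :
    eval f t y -> eval (Prim f g) [tuple of 0 :: t] y
| eval_PrimS n (f : recf n) g (t : n.-tuple nat) k z y :
    eval (Prim f g) [tuple of k :: t] z ->
    eval g [tuple of k :: z :: t] y ->
    eval (Prim f g) [tuple of k.+1 :: t] y
| eval_Mu n (f : recf n.+1) (t : n.-tuple nat) k (h : nat -> nat) :
    (forall j, j < k -> eval f [tuple of j :: t] (h j).+1) ->
    eval f [tuple of k :: t] 0 ->
    eval (Mu f) t k.

(** Partial recursive programs suffice for total functions; a function whose
    domain is computable is computable iff it extends to such a total one. *)
Definition computable n (f : n.-tuple HF -> HF) : Prop :=
  exists p : recf n, forall t, eval p t (f t).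

Definition computable_fun (f : HF -> HF) : Prop :=
  computable (fun t : 1.-tuple HF => f (thead t)).

Definition computable_rel n (R : n.-tuple HF -> Prop) : Prop :=
  computable (fun t => nat_of_bool `[< R t >]).

Definition computable_set (D : set HF) : Prop :=
  computable_fun (fun x => nat_of_bool `[< D x >]).

Inductive walk (V : Type) (E : V -> V -> Prop) : nat -> V -> V -> Prop :=
| walk0 x : walk E 0 x x
| walkS k x y z : walk E k x y -> E y z -> walk E k.+1 x z.

(** The path metric of [E] between [x] and [y] is at most [r]. *)
Definition dist_le (V : Type) (E : V -> V -> Prop) (r : nat) (x y : V) : Prop :=
  exists2 k, k <= r & walk E k x y.

Definition component (V : Type) (E : V -> V -> Prop) (x : V) : set V :=
  [set y | exists k, walk E k x y].

Definition power (V : Type) (E : V -> V -> Prop) (r : nat) (x y : V) : Prop :=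
  x <> y /\ dist_le E r x y.

(** The points outside [U] become isolated instead of being removed. *)
Definition induced (V : Type) (U : set V) (E : V -> V -> Prop) (x y : V) : Prop :=
  [/\ U x, U y & E x y].

Lemma walk_cat V (E : V -> V -> Prop) k l x y z :
  walk E k x y -> walk E l y z -> walk E (k + l) x z.
Proof.
move=> wx wy; elim: wy wx => [y'|{}l y' u v _ IH e] wx; first by rewrite addn0.
by rewrite addnS; apply: walkS (IH wx) e.
Qed.

Lemma walk_sym V (E : V -> V -> Prop) (symE : forall x y, E x y -> E y x) k x y :
  walk E k x y -> walk E k y x.
Proof.
elim=> [u|{}k u v w _ IH e]; first exact: walk0.
by rewrite -[k.+1]add1n; apply: walk_cat IH; apply: walkS (walk0 _ _) (symE _ _ e).
Qed.

Lemma finite_dist_le V (E : V -> V -> Prop) r x :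
  (forall y, finite_set (E y)) -> finite_set (dist_le E r x).
Proof.
move=> lf.
have finw k : finite_set (walk E k x).
  elim: k => [|k IH].
    apply: (sub_finite_set _ (finite_set1 x)) => y w.
    by inversion w.
  apply: (@sub_finite_set _ _ (\bigcup_(y in walk E k x) E y)) => [z w|].
    by inversion w; subst; exists y.
  exact: bigcup_finite.
apply: (@sub_finite_set _ _ (\bigcup_(k in `I_r.+1) walk E k x)).
  by move=> y [k kr w]; exists k.
by apply: bigcup_finite => //; apply: finite_II.
Qed.

(** The arities of the relation symbols other than adjacency. *)
Definition language := seq nat.

Definition arity (L : language) (i : 'I_(size L)) : nat := nth 0 L i.

Record sgraph (L : language) (V : Type) := SGraph {
  adj : V -> V -> Prop;
  srel : forall i : 'I_(size L), (arity i).-tuple V -> Prop;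
  adj_sym : forall x y, adj x y -> adj y x;
  adj_irr : forall x, ~ adj x x;
  locally_finite : forall x, finite_set [set y | adj x y] }.

Definition sg_iso (L : language) (V V' : Type)
    (G : sgraph L V) (G' : sgraph L V') (phi : V -> V') : Prop :=
  [/\ bijective phi,
      forall x y, adj G x y <-> adj G' (phi x) (phi y) &
      forall i (t : (arity i).-tuple V), srel G t <-> srel G' (map_tuple phi t)].

Lemma restrict_locally_finite L V (G : sgraph L V) (W : set V) (x : {x | W x}) :
  finite_set [set y : {x | W x} | adj G (sval x) (sval y)].
Proof.
apply: (@finite_preimage _ _ [set y | adj G (sval x) y] sval).
  by move=> [a p] [b q] _ _ /= e; subst b; congr exist; apply: Prop_irrelevance.
exact: locally_finite.
Qed.

Definition restrict (L : language) (V : Type) (G : sgraph L V) (W : set V) :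
    sgraph L {x | W x} :=
  @SGraph L {x | W x}
    (fun x y => adj G (sval x) (sval y))
    (fun i t => srel G (map_tuple sval t))
    (fun x y => @adj_sym L V G (sval x) (sval y))
    (fun x => @adj_irr L V G (sval x))
    (@restrict_locally_finite L V G W).

Record coloring_problem (L : language) := ColoringProblem {
  Gam : forall V : Type, sgraph L V -> Prop;
  Pi : forall V : Type, sgraph L V -> (V -> HF) -> Prop;
  Gam_iso : forall V V' (G : sgraph L V) (G' : sgraph L V') phi,
    sg_iso G G' phi -> Gam G -> Gam G';
  Gam_component : forall V (G : sgraph L V),
    Gam G <-> forall x, Gam (restrict G (component (adj G) x));
  Pi_Gam : forall V (G : sgraph L V) c, Pi G c -> Gam G;
  Pi_iso : forall V V' (G : sgraph L V) (G' : sgraph L V') phi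
      (c : V -> HF) (c' : V' -> HF),
    sg_iso G G' phi -> (forall x, c' (phi x) = c x) -> Pi G c -> Pi G' c';
  Pi_component : forall V (G : sgraph L V) (c : V -> HF),
    Pi G c <->
    forall x, Pi (restrict G (component (adj G) x)) (fun y => c (sval y)) }.

Definition linear_order (V : Type) (lt : V -> V -> Prop) : Prop :=
  [/\ forall x, ~ lt x x,
      forall x y z, lt x y -> lt y z -> lt x z &
      forall x y, [\/ lt x y, x = y | lt y x]].

(** A partition [U_0, ..., U_s], with possibly empty parts, is given by the
    function [part] with [U_i = part @^-1` [set i]]. *)
Record asi_input (L : language) (s : nat) (V : Type) := AsiInput {
  in_graph : sgraph L V;
  in_finite : finite_set [set: V];
  in_lt : V -> V -> Prop;
  in_linear : linear_order in_lt;
  in_part : V -> 'I_s.+1;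
  in_target : set V }.

Definition input_iso (L : language) (s : nat) (V V' : Type)
    (I : asi_input L s V) (I' : asi_input L s V') (phi : V -> V') : Prop :=
  [/\ sg_iso (in_graph I) (in_graph I') phi,
      forall x y, in_lt I x y <-> in_lt I' (phi x) (phi y),
      forall x, in_part I' (phi x) = in_part I x &
      forall x, in_target I x <-> in_target I' (phi x)].

Record asi_algorithm (L : language) (s : nat) := AsiAlgorithm {
  run : forall V (I : asi_input L s V), {x | in_target I x} -> HF;
  run_iso : forall V V' (I : asi_input L s V) (I' : asi_input L s V') phi,
    input_iso I I' phi ->
    forall (x : {x | in_target I x}) (x' : {x | in_target I' x}),
      sval x' = phi (sval x) -> run x = run x' }.

(** The canonical HF code of an input on [n] vertices is the tuple of sets
    representing its unique copy with vertices [0, ..., n-1] in increasing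
    order; [e] is the corresponding relabelling. *)
Definition canonical_labelling (L : language) (s : nat) (V : Type)
    (I : asi_input L s V) (e : V -> HF) : Prop :=
  (exists n, set_bij [set: V] `I_n e) /\
  (forall x y, in_lt I x y <-> e x < e y).

Definition input_code (L : language) (s : nat) (V : Type)
    (I : asi_input L s V) (e : V -> HF) : HF :=
  let G := in_graph I in
  hf_list
    [:: hf_set (range e);
        hf_set [set z | exists x y, adj G x y /\ z = hf_pair (e x) (e y)];
        hf_list [seq hf_set [set z | exists t : (arity i).-tuple V,
                                       srel G t /\ z = hf_list (map e t)]
                | i <- enum 'I_(size L)];
        hf_set [set z | exists x y, in_lt I x y /\ z = hf_pair (e x) (e y)];
        hf_list [seq hf_set [set z | exists x, in_part I x = i /\ z = e x]
                | i <- enum 'I_s.+1];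
        hf_set [set z | exists x, in_target I x /\ z = e x]].

(** The function returned by the algorithm, as a set of pairs. *)
Definition output_code (L : language) (s : nat) (A : asi_algorithm L s)
    (V : Type) (I : asi_input L s V) (e : V -> HF) : HF :=
  hf_set (range (fun x : {x | in_target I x} => hf_pair (e (sval x)) (run A x))).

Definition computable_algorithm (L : language) (s : nat)
    (A : asi_algorithm L s) : Prop :=
  exists F : HF -> HF, computable_fun F /\
    forall V (I : asi_input L s V) (e : V -> HF), canonical_labelling I e ->
      F (input_code I e) = output_code A I e.

Section Witness.
Variables (L : language) (V : Type) (G : sgraph L V) (s r : nat).
Variable part : V -> 'I_s.+1.

(** The component containing [x] of the graph [G^r] restricted to the part
    [U_i] containing [x]. *)
Definition block (x : V) : set V :=
  component (induced [set y | part y = part x] (power (adj G) r)) x.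

Definition asi_witness : Prop := forall x, finite_set (block x).

Definition blocks : set (set V) := range block.

Definition block_adj (C D : set V) : Prop :=
  [/\ blocks C, blocks D, C <> D &
      exists x y, [/\ C x, D y & dist_le (adj G) r x y]].

Definition block_ball (n : nat) (C : set V) : set V :=
  [set y | exists D, [/\ blocks D, dist_le block_adj n C D & D y]].

Lemma block_refl x : block x x.
Proof. by exists 0; apply: walk0. Qed.

Lemma block_ball_refl n x : block_ball n (block x) x.
Proof.
exists (block x); split; [by exists x| |exact: block_refl].
by exists 0 => //; apply: walk0.
Qed.

Lemma block_part x y : block x y -> part y = part x.
Proof. by move=> [k w]; inversion w => //; subst; case: H0. Qed.

Lemma block_sub x y z : block x y -> block x z -> block y z.
Proof.
move=> xy; have p := block_part xy; case: xy => k w [l w'].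
exists (k + l); rewrite p; apply: walk_cat w'.
apply: walk_sym w => a b [ua ub [ab [j jr wj]]]; split => //.
split; first by move=> e; apply: ab.
by exists j => //; apply: walk_sym wj; apply: adj_sym.
Qed.

Lemma finite_block_ball n x : asi_witness -> finite_set (block_ball n (block x)).
Proof.
move=> wit.
pose S k := [set y | exists D, walk block_adj k (block x) D /\ D y].
have finS k : finite_set (S k).
  elim: k => [|k IH].
    apply: (sub_finite_set _ (wit x)) => y [D [w Dy]].
    by inversion w; subst.
  apply: (@sub_finite_set _ _ (\bigcup_(a in S k)
            \bigcup_(b in dist_le (adj G) r a) block b)).
    move=> y [D [w Dy]]; inversion w; subst.
    case: H1 => _ [u _ uD] _ [a [b [ya Db ab]]]; subst D.
    exists a; first by exists y0.
    by exists b => //; apply: block_sub Db Dy.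
  apply: bigcup_finite => // a _; apply: bigcup_finite => // .
  by apply: finite_dist_le; apply: locally_finite.
apply: (@sub_finite_set _ _ (\bigcup_(k in `I_n.+1) S k)).
  by move=> y [D [_ [k kn w] Dy]]; exists k => //; exists D.
by apply: bigcup_finite => //; apply: finite_II.
Qed.

End Witness.

Lemma finite_setT_sig V (W : set V) :
  finite_set W -> finite_set [set: {x | W x}].
Proof.
move=> fW; apply: (@sub_finite_set _ _ (sval @^-1` W)) => [[x Wx] _ //|].
apply: finite_preimage fW => -[a p] [b q] _ _ /= e.
by subst b; congr exist; apply: Prop_irrelevance.
Qed.

Lemma linear_order_sig V (lt : V -> V -> Prop) (W : set V) : linear_order lt ->
  linear_order (fun x y : {x | W x} => lt (sval x) (sval y)).
Proof.
move=> [irr tr tot]; split=> [x|x y z|[x p] [y q]] /=; [exact: irr|exact: tr|].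
case: (tot x y) => [h|h|h]; [exact: Or31| |exact: Or33].
by apply: Or32; subst y; congr exist; apply: Prop_irrelevance.
Qed.

Definition local_input (L : language) (V : Type) (G : sgraph L V) (s r : nat)
    (part : V -> 'I_s.+1) (wit : asi_witness G r part)
    (lt : V -> V -> Prop) (lin : linear_order lt) (n : nat) (x : V) :
    asi_input L s {y | block_ball G r part n (block G r part x) y} :=
  let W := block_ball G r part n (block G r part x) in
  @AsiInput L s {y | W y}
    (restrict G W)
    (finite_setT_sig (finite_block_ball n x wit))
    (fun y z => lt (sval y) (sval z))
    (@linear_order_sig V lt W lin)
    (fun y => part (sval y))
    [set y | block G r part x (sval y)].

(** The coloring [A_n[(G, <, U_0, ..., U_s)]]. *)
Definition asi_coloring (L : language) (s : nat) (A : asi_algorithm L s)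
    (V : Type) (G : sgraph L V) (r : nat)
    (part : V -> 'I_s.+1) (wit : asi_witness G r part)
    (lt : V -> V -> Prop) (lin : linear_order lt) (n : nat) (x : V) : HF :=
  run A (I := local_input wit lin n x)
    (exist (in_target (local_input wit lin n x))
      (exist _ x (block_ball_refl G r part n x)) (block_refl G r part x)).

Definition ASIc (L : language) (s : nat) (P : coloring_problem L) : Prop :=
  exists A : asi_algorithm L s, computable_algorithm A /\
  exists n r : nat,
    forall V (G : sgraph L V), Gam P G ->
    forall (lt : V -> V -> Prop) (lin : linear_order lt)
      (part : V -> 'I_s.+1) (wit : asi_witness G r part),
      Pi P G (asi_coloring A wit lin n).

(** For graphs whose vertex set is the subset [D] of HF. *)
Definition highly_computable (L : language) (D : set HF)
    (G : sgraph L {x | D x}) : Prop :=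
  [/\ computable_set D,
      computable_rel (fun t : 2.-tuple HF =>
        exists x y, adj G x y /\ t = [tuple sval x; sval y]),
      forall i, computable_rel (fun t : (arity i).-tuple HF =>
        exists u : (arity i).-tuple {x | D x},
          srel G u /\ t = map_tuple sval u) &
      exists f : HF -> nat, computable_fun f /\
        forall x, [set y | adj G x y] #= `I_(f (sval x))].

Definition computable_coloring (D : set HF) (c : {x | D x} -> HF) : Prop :=
  exists f : HF -> HF, computable_fun f /\ forall x, c x = f (sval x).

Definition HComp (L : language) (P : coloring_problem L) : Prop :=
  forall (D : set HF) (G : sgraph L {x | D x}),
    Gam P G -> highly_computable G ->
    exists c : {x | D x} -> HF, Pi P G c /\ computable_coloring c.

(* Main.v *)
(** Exhaust the vertex set by finite sets [F 0 = set0] and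
    [F k.+1 = B_d(F k) `|` ([set k] `&` D)], and split the vertices according to
    the parity of the stage at which they appear.  Points at distance at most
    [d] appear at stages that differ by at most one, so a block stays inside a
    single stage and is finite: the two parts form a witness of scale [d].
    Because degrees are computable, the stages, the blocks and the balls of
    blocks are computable finite sets, and so are the canonical codes of the
    local inputs (vertices are relabelled by their rank in the ball); the given
    algorithm then computes the colors.  Computability is obtained by searching:
    a total function with a semidecidable graph is computable. *)

From mathcomp Require Import all_boot finmap.
From mathcomp Require Import boolp classical_sets functions cardinality fsbigop.
Require Import Defs.

Set Implicit Arguments.
Unset Strict Implicit.
Unset Printing Implicit Defensive.

Local Open Scope classical_set_scope.
Local Open Scope card_scope.
Local Open Scope nat_scope.

(** * Computable functions of an environment *)

(** The obstacle is that a component of [G] may be infinite, so no finite search exhausts it; the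
    witness must have blocks that a program can recognise as complete. Two classes are all that
    [s = 1] offers, and parity is enough because only consecutive stages have to be separated.
    [ASIc] quantifies over all linear orders, so the numerical order of the vertices may be chosen,
    and canonical relabelling becomes counting. Decidable membership in a finite set is not enough:
    the code handed to the algorithm must list every element, so each finite set needs a certificate
    that nothing is missing. For a neighbourhood it is the degree, for a component it is closure
    under steps, for a union it is containment of the pieces. Programs act on numbers and not on the
    subtype of [D], so the graph notions are copied to relations on all of [HF], where the points
    outside [D] are isolated. *)

(** Free variables are de Bruijn indices: an operator that binds [x] in [f x r]
    asks for the computability of [fun r => f (r 0) (fun i => r i.+1)]. *)
Definition env := nat -> nat.

Definition scons (x : nat) (r : env) : env := fun i => if i is j.+1 then r j else x.

Definition env_tuple n (r : env) : n.-tuple nat := [tuple r i | i < n].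

(** The program reads a finite prefix of the environment. Its length is existential, so the closure
    lemmas need not keep track of arities. *)
Definition rf (f : env -> nat) : Prop :=
  exists n (p : recf n), forall r, eval p (env_tuple n r) (f r).

Lemma env_tupleS n (r : env) :
  env_tuple n.+1 r = [tuple of r 0 :: env_tuple n (fun i => r i.+1)].
Proof.
apply: eq_from_tnth => i; rewrite tnth_mktuple; case: (unliftP ord0 i) => [j ->|->].
  by rewrite tnthS tnth_mktuple.
by rewrite tnth0.
Qed.

Lemma env_tuple_scons n x (r : env) :
  env_tuple n.+1 (scons x r) = [tuple of x :: env_tuple n r].
Proof. by rewrite env_tupleS. Qed.

Lemma rf_ext f g : rf f -> f =1 g -> rf g.
Proof. by move=> [n [p H]] fg; exists n, p => r; rewrite -fg. Qed.

Lemma rf_weaken f : rf f -> exists n0, forall n, n0 <= n ->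
  exists p : recf n, forall r, eval p (env_tuple n r) (f r).
Proof.
move=> [n0 [p H]]; exists n0 => n le.
exists (Comp p (fun i => Proj (widen_ord le i))) => r.
apply: (@eval_Comp _ _ _ _ _ (env_tuple n0 r)) => // i.
have -> : tnth (env_tuple n0 r) i = tnth (env_tuple n r) (widen_ord le i).
  by rewrite !tnth_mktuple.
exact: eval_Proj.
Qed.

Lemma rf_var k : rf (fun r => r k).
Proof.
exists k.+1, (Proj (@ord_max k)) => r.
have -> : r k = tnth (env_tuple k.+1 r) ord_max by rewrite tnth_mktuple.
exact: eval_Proj.
Qed.

(** Since [f] reads only [n] variables, only [n] of the infinitely many programs for [s] matter, and
    these can be brought to one arity [N]. *)
Lemma rf_subst f (s : nat -> env -> nat) :
  rf f -> (forall k, rf (s k)) -> rf (fun r => f (fun k => s k r)).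
Proof.
move=> [n [p H]] Hs.
have [m Hm] := choice (fun k => rf_weaken (Hs k)).
pose N := \max_(i < n) m i.
have [q Hq] := choice (fun i : 'I_n => Hm i N (@leq_bigmax _ (fun i : 'I_n => m i) i)).
exists N, (Comp p q) => r; apply: eval_Comp (H _) => i.
by rewrite tnth_mktuple.
Qed.

Lemma rf_shift f : rf f -> rf (fun r => f (fun i => r i.+1)).
Proof. by move=> rff; apply: (rf_subst (s := fun k r => r k.+1) rff) => k; apply: rf_var. Qed.

Lemma rf_app (f : nat -> env -> nat) g : rf (fun r => f (r 0) (fun i => r i.+1)) ->
  rf g -> rf (fun r => f (g r) r).
Proof.
move=> Hf Hg.
apply: (rf_subst (s := fun k r => scons (g r) r k) Hf) => -[|k] //=.
exact: rf_var.
Qed.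

Lemma rf_zero : rf (fun=> 0).
Proof. by exists 0, (Zero 0) => r; apply: eval_Zero. Qed.

Lemma rf_succ f : rf f -> rf (fun r => (f r).+1).
Proof.
apply: (@rf_app (fun x _ => x.+1)); exists 1, Succ => r.
have -> : env_tuple 1 r = [tuple r 0] 
  by apply: eq_from_tnth => i; rewrite tnth_mktuple (ord1 i).
exact: eval_Succ.
Qed.

Lemma rf_const c : rf (fun=> c).
Proof. by elim: c => [|c IH]; [apply: rf_zero|apply: rf_succ]. Qed.

Fixpoint prec (b : nat) (s : nat -> nat -> nat) (k : nat) : nat :=
  if k is j.+1 then s j (prec b s j) else b.

Lemma rf_prec h f (g : nat -> nat -> env -> nat) : rf h -> rf f ->
  rf (fun r => g (r 0) (r 1) (fun i => r i.+2)) ->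
  rf (fun r => prec (f r) (fun k z => g k z r) (h r)).
Proof.
move=> Hh Hf Hg.
apply: (@rf_app (fun x r => prec (f r) (fun k z => g k z r) x)) => //.
have [nf {}Hf] := rf_weaken Hf; have [ng {}Hg] := rf_weaken Hg.
pose n := maxn nf ng.
have [p Hp] := Hf n (leq_maxl _ _).
have [|q Hq] := Hg n.+2; first by apply: leq_trans (leq_maxr nf ng) _; rewrite 2?leqW.
exists n.+1, (Prim p q) => r; rewrite env_tupleS.
set r' := (fun i => r i.+1); elim: (r 0) => [|k IH] /=; first exact: eval_Prim0.
apply: eval_PrimS IH _.
have := Hq (scons k (scons (prec (f r') (fun k z => g k z r') k) r')).
by rewrite !env_tuple_scons.
Qed.

Lemma rf_add f g : rf f -> rf g -> rf (fun r => f r + g r).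
Proof.
move=> Hf Hg.
apply: (@rf_ext (fun r => prec (f r) (fun _ z => z.+1) (g r))).
  by apply: (@rf_prec _ _ (fun _ z _ => z.+1)) => //; apply: rf_succ; apply: rf_var.
by move=> r; elim: (g r) => [|k IH] /=; rewrite ?addn0 // IH addnS.
Qed.

Lemma rf_sub f g : rf f -> rf g -> rf (fun r => f r - g r).
Proof.
move=> Hf Hg.
have Hp h : rf h -> rf (fun r => (h r).-1).
  move=> Hh; apply: (@rf_ext (fun r => prec 0 (fun k _ => k) (h r))).
    by apply: (@rf_prec _ _ (fun k _ _ => k)) => //; [apply: rf_zero|apply: rf_var].
  by move=> r; case: (h r).
apply: (@rf_ext (fun r => prec (f r) (fun _ z => z.-1) (g r))).
  by apply: (@rf_prec _ _ (fun _ z _ => z.-1)) => //; apply: Hp; apply: rf_var.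
by move=> r; elim: (g r) => [|k IH] /=; rewrite ?subn0 // IH subnS.
Qed.

Lemma rf_mul f g : rf f -> rf g -> rf (fun r => f r * g r).
Proof.
move=> Hf Hg.
apply: (@rf_ext (fun r => prec 0 (fun _ z => f r + z) (g r))).
  apply: (@rf_prec _ _ (fun _ z r => f r + z)) => //; first exact: rf_zero.
  by apply: rf_add (rf_var 1); apply: (rf_shift (rf_shift Hf)).
by move=> r; elim: (g r) => [|k IH] /=; rewrite ?muln0 // IH mulnS.
Qed.

Lemma rf_exp2 f : rf f -> rf (fun r => 2 ^ f r).
Proof.
move=> Hf; apply: (@rf_ext (fun r => prec 1 (fun _ z => z + z) (f r))).
  apply: (@rf_prec _ _ (fun _ z _ => z + z)) => //; first exact: rf_const.
  by apply: rf_add; apply: rf_var.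
by move=> r; elim: (f r) => [|k IH] //=; rewrite IH addnn expnS mul2n.
Qed.

Lemma rf_sum h (f : nat -> env -> nat) : rf h ->
  rf (fun r => f (r 0) (fun i => r i.+1)) -> rf (fun r => \sum_(x < h r) f x r).
Proof.
move=> Hh Hf; apply: (@rf_ext (fun r => prec 0 (fun k z => z + f k r) (h r))).
  apply: (@rf_prec _ _ (fun k z r => z + f k r)) => //; first exact: rf_zero.
  apply: rf_add; first exact: rf_var.
  apply: (rf_subst (s := fun k r => if k is j.+1 then r j.+2 else r 0) Hf).
  by case=> [|k]; apply: rf_var.
by move=> r; elim: (h r) => [|k IH] /=; rewrite ?big_ord0 // big_ord_recr IH.
Qed.

Lemma rf_prod h (f : nat -> env -> nat) : rf h ->
  rf (fun r => f (r 0) (fun i => r i.+1)) -> rf (fun r => \prod_(x < h r) f x r).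
Proof.
move=> Hh Hf; apply: (@rf_ext (fun r => prec 1 (fun k z => z * f k r) (h r))).
  apply: (@rf_prec _ _ (fun k z r => z * f k r)) => //; first exact: rf_const.
  apply: rf_mul; first exact: rf_var.
  apply: (rf_subst (s := fun k r => if k is j.+1 then r j.+2 else r 0) Hf).
  by case=> [|k]; apply: rf_var.
by move=> r; elim: (h r) => [|k IH] /=; rewrite ?big_ord0 // big_ord_recr IH.
Qed.

Lemma rf_mu (f : nat -> env -> nat) : rf (fun r => f (r 0) (fun i => r i.+1)) ->
  (forall r, exists k, f k r = 0) -> exists2 m, rf m & forall r, f (m r) r = 0.
Proof.
move=> Hf tot.
have tot' r : exists k, f k r == 0 by have [k /eqP] := tot r; exists k.
pose m r := ex_minn (tot' r).
exists m; last by move=> r; rewrite /m; case: ex_minnP => k /eqP.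
have [n0 /(_ n0.+1 (leqnSn _)) [p Hp]] := rf_weaken Hf.
exists n0, (Mu p) => r; rewrite /m; case: ex_minnP => k /eqP fk mk.
(* [eval_Mu] records the nonzero values before [k] as successors, hence the predecessor. *)
apply: (@eval_Mu _ _ _ _ (fun j => (f j r).-1)) => [j jk|].
  rewrite -env_tuple_scons prednK; first exact: (Hp (scons j r)).
  by rewrite lt0n; apply/negP => /mk; rewrite leqNgt jk.
by rewrite -env_tuple_scons -fk; apply: (Hp (scons k r)).
Qed.

(** * Semidecidable and decidable relations *)

(** Truth is the value 0, so products act as disjunctions and bounded existentials, sums as
    conjunctions and bounded universals. *)
Definition re (P : env -> Prop) : Prop :=
  exists2 f : nat -> env -> nat, rf (fun r => f (r 0) (fun i => r i.+1)) &
    forall r, P r <-> exists w, f w r = 0.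

Lemma prod0P h (f : nat -> nat) :
  \prod_(x < h) f x = 0 <-> exists2 x, x < h & f x = 0.
Proof.
split=> [|[x xh fx]]; last by rewrite (bigD1 (Ordinal xh)) //= fx.
elim: h => [|h IH]; first by rewrite big_ord0.
rewrite big_ord_recr /= => /eqP; rewrite muln_eq0 => /orP [/eqP /IH [x xh e]|/eqP e].
  by exists x => //; apply: ltnW.
by exists h.
Qed.

Lemma sum0P h (f : nat -> nat) :
  \sum_(x < h) f x = 0 <-> forall x, x < h -> f x = 0.
Proof.
split=> [/eqP|H]; last by apply: big1 => i _; apply: H.
by rewrite sum_nat_eq0 => /forallP H x xh; apply/eqP; apply: (H (Ordinal xh)).
Qed.

Lemma re_ext P Q : re P -> (forall r, P r <-> Q r) -> re Q.
Proof. by move=> [f Hf H] PQ; exists f => // r; rewrite -PQ. Qed.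

Lemma re_subst P (s : nat -> env -> nat) :
  re P -> (forall k, rf (s k)) -> re (fun r => P (fun k => s k r)).
Proof.
move=> [f Hf H] Hs; exists (fun w r => f w (fun k => s k r)) => //.
apply: (rf_subst (s := fun k r => if k is j.+1 then s j (fun i => r i.+1) else r 0) Hf).
by case=> [|k]; [apply: rf_var|apply: rf_shift].
Qed.

Lemma re_eq f g : rf f -> rf g -> re (fun r => f r = g r).
Proof.
move=> Hf Hg; exists (fun _ r => (f r - g r) + (g r - f r)).
  by apply: rf_add; apply: rf_sub; apply: rf_shift.
move=> r; split=> [->|[_ /eqP]]; first by exists 0; rewrite subnn.
by rewrite addn_eq0 !subn_eq0 -eqn_leq => /eqP.
Qed.

Lemma re_or P Q : re P -> re Q -> re (fun r => P r \/ Q r).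
Proof.
move=> [f Hf HP] [g Hg HQ]; exists (fun w r => f w r * g w r); first exact: rf_mul.
move=> r; rewrite HP HQ; split=> [[] [w e]|[w /eqP]].
- by exists w; rewrite e.
- by exists w; rewrite e muln0.
- by rewrite muln_eq0 => /orP [] /eqP; [left|right]; exists w.
Qed.

Lemma rf_prod_le (f : nat -> nat -> env -> nat) :
  rf (fun r => f (r 0) (r 1) (fun i => r i.+2)) ->
  rf (fun r => \prod_(w < (r 0).+1) f w (r 0) (fun i => r i.+1)).
Proof.
move=> Hf.
by apply: (@rf_prod _ (fun w r => f w (r 0) (fun i => r i.+1))) => //;
  apply: rf_succ; apply: rf_var.
Qed.

(** Several existential witnesses are merged by bounding all of them with a
    single number, so no pairing function is needed. *)
Lemma re_bounded (f : nat -> env -> nat) r :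
  (exists w, f w r = 0) <-> exists W, forall W', W <= W' -> \prod_(w < W'.+1) f w r = 0.
Proof.
split=> [[w e]|[W H]].
  by exists w => W' le; apply/(prod0P _ (fun w => f w r)); exists w.
by have /(prod0P _ (fun w => f w r)) [w _ e] := H W (leqnn _); exists w.
Qed.

Lemma re_and P Q : re P -> re Q -> re (fun r => P r /\ Q r).
Proof.
move=> [f Hf HP] [g Hg HQ].
exists (fun W r => \prod_(w < W.+1) f w r + \prod_(w < W.+1) g w r).
  apply: rf_add; apply: (@rf_prod_le (fun w _ r => _ w r)).
    by apply: (rf_subst (s := fun k r => if k is j.+1 then r j.+2 else r 0) Hf);
      case=> [|k]; apply: rf_var.
  by apply: (rf_subst (s := fun k r => if k is j.+1 then r j.+2 else r 0) Hg);
    case=> [|k]; apply: rf_var.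
move=> r; rewrite HP HQ !re_bounded; split=> [[[a Ha] [b Hb]]|[W /eqP]].
  by exists (maxn a b); rewrite Ha ?leq_maxl // Hb ?leq_maxr.
rewrite addn_eq0 => /andP [].
move=> /eqP /(prod0P _ (fun w => f w r)) [a _ ea].
move=> /eqP /(prod0P _ (fun w => g w r)) [b _ eb].
by split; apply/re_bounded; [exists a|exists b].
Qed.

Lemma re_ex (P : nat -> env -> Prop) : re (fun r => P (r 0) (fun i => r i.+1)) ->
  re (fun r => exists x, P x r).
Proof.
move=> [f Hf HP].
exists (fun W r => \prod_(x < W.+1) \prod_(w < W.+1) f w (scons x r)).
  apply: (@rf_prod_le (fun x W r => \prod_(w < W.+1) f w (scons x r))).
  apply: (@rf_prod _ (fun w r => f w (scons (r 0) (fun i => r i.+2)))).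
    by apply: rf_succ; apply: rf_var.
  apply: (rf_subst (s := fun k r => match k with 0 => r 0 | 1 => r 1 | j.+2 => r j.+3 end)
    (f := fun r => f (r 0) (scons (r 1) (fun i => r i.+2)))).
    apply: (rf_ext Hf) => r; congr f; apply: funext => -[|k] //.
  by case=> [|[|k]]; apply: rf_var.
move=> r; split=> [[x Px]|[W]]; last first.
  move=> /(prod0P _ (fun x => \prod_(w < W.+1) f w (scons x r))) [x _].
  move=> /(prod0P _ (fun w => f w (scons x r))) [w _ e].
  by exists x; apply/(HP (scons x r)); exists w.
have /HP [w e] : P (scons x r 0) (fun i => scons x r i.+1) by [].
exists (maxn x w); apply/(prod0P _ (fun x => \prod_(w < _) f w (scons x r))).
exists x; first by rewrite ltnS leq_maxl.
by apply/(prod0P _ (fun w => f w (scons x r))); exists w => //; rewrite ltnS leq_maxr.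
Qed.

(** Finitely many [x] have finitely many least witnesses, so a single bound [W] serves all of
    them. *)
Lemma re_all_lt h (P : nat -> env -> Prop) : rf h ->
  re (fun r => P (r 0) (fun i => r i.+1)) -> re (fun r => forall x, x < h r -> P x r).
Proof.
move=> Hh [f Hf HP].
exists (fun W r => \sum_(x < h r) \prod_(w < W.+1) f w (scons x r)).
  apply: (@rf_sum _ (fun x r => \prod_(w < (r 0).+1) f w (scons x (fun i => r i.+1)))).
    exact: rf_shift.
  apply: (@rf_prod _ (fun w r => f w (scons (r 0) (fun i => r i.+2)))).
    by apply: rf_succ; apply: rf_var.
  apply: (rf_subst (s := fun k r => match k with 0 => r 0 | 1 => r 1 | j.+2 => r j.+3 end)
    (f := fun r => f (r 0) (scons (r 1) (fun i => r i.+2)))).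
    by apply: (rf_ext Hf) => r; congr f; apply: funext => -[|k].
  by case=> [|[|k]]; apply: rf_var.
move=> r; split=> [H|[W /(sum0P _ (fun x => \prod_(w < W.+1) f w (scons x r))) H] x]; last first.
  move=> /H /(prod0P _ (fun w => f w (scons x r))) [w _ e].
  by apply/(HP (scons x r)); exists w.
have [W HW] : exists W, forall W', W <= W' -> forall x, x < h r ->
    \prod_(w < W'.+1) f w (scons x r) = 0.
  elim: (h r) H => [|k IH] H; first by exists 0.
  have [W HW] := IH (fun x xk => H x (ltnW xk)).
  have /HP /re_bounded [W2 HW2] : P (scons k r 0) (fun i => scons k r i.+1) by apply: H.
  exists (maxn W W2) => W'; rewrite geq_max => /andP [l1 l2] x.
  rewrite ltnS leq_eqVlt => /orP [/eqP -> | xk]; [exact: HW2|exact: HW].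
by exists W; apply/(sum0P _ (fun x => \prod_(w < _) f w (scons x r))) => x; apply: HW.
Qed.

(** A first search finds [K] bounding some value together with its witness; a second one finds a
    value that has a witness up to [K]. Values are unique, so whatever is found is [f r]. *)
Lemma rf_graph f (R : nat -> env -> Prop) : re (fun r => R (r 0) (fun i => r i.+1)) ->
  (forall y r, R y r <-> y = f r) -> rf f.
Proof.
move=> [g Hg HR] Rf.
have HR' y r : R y r <-> exists w, g w (scons y r) = 0 by rewrite -(HR (scons y r)).
have Hgs (s : env -> nat) (t : env -> nat) (u : env -> env) : rf s -> rf t ->
    (forall k, rf (fun r => u r k)) -> rf (fun r => g (s r) (scons (t r) (u r))).
  move=> Hs Ht Hu.
  apply: (rf_subst (s := fun k r => match k with 0 => s r | 1 => t r | j.+2 => u r j end)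
    (f := fun r => g (r 0) (scons (r 1) (fun i => r i.+2)))).
    by apply: (rf_ext Hg) => r; congr g; apply: funext => -[|k].
  by case=> [|[|k]].
have [|r|K HK Kg] := @rf_mu (fun K r => \prod_(y < K.+1) \prod_(w < K.+1) g w (scons y r)).
- apply: (@rf_prod_le (fun x W r => \prod_(w < W.+1) g w (scons x r))).
  apply: (@rf_prod _ (fun w r => g w (scons (r 0) (fun i => r i.+2)))).
    by apply: rf_succ; apply: rf_var.
  by apply: (Hgs _ _ (fun r i => r i.+3)) => *; apply: rf_var.
- have /HR' [w e] : R (f r) r by apply/Rf.
  exists (maxn (f r) w); apply/(prod0P _ (fun x => \prod_(w < _) g w (scons x r))).
  exists (f r); first by rewrite ltnS leq_maxl.
  by apply/(prod0P _ (fun w => g w (scons (f r) r))); exists w => //; rewrite ltnS leq_maxr.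
have [|r|m Hm mg] := @rf_mu (fun y r => \prod_(w < (K r).+1) g w (scons y r)).
- apply: (@rf_prod _ (fun w r => g w (scons (r 0) (fun i => r i.+1)))).
    by apply: rf_succ; apply: rf_shift.
  by apply: (Hgs _ _ (fun r i => r i.+2)) => *; apply: rf_var.
- by have /(prod0P _ (fun y => \prod_(w < _) g w (scons y r))) [y _ e] := Kg r; exists y.
apply: (rf_ext Hm) => r; apply/Rf/HR'.
by have /(prod0P _ (fun w => g w (scons (m r) r))) [w _ e] := mg r; exists w.
Qed.

Lemma re_lt f g : rf f -> rf g -> re (fun r => f r < g r).
Proof.
move=> Hf Hg; apply: (@re_ext (fun r => exists d, (f r + d).+1 = g r)).
  apply: re_ex; apply: re_eq (rf_shift Hg).
  by apply: rf_succ; apply: rf_add (rf_var 0); apply: rf_shift.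
move=> r; split=> [[d <-]|lt]; first by rewrite ltnS leq_addr.
by exists (g r - (f r).+1); rewrite -addSn subnKC.
Qed.

Definition dec (P : env -> Prop) : Prop := re P /\ re (fun r => ~ P r).

Lemma dec_ext P Q : dec P -> (forall r, P r <-> Q r) -> dec Q.
Proof.
move=> [a b] PQ; split; first exact: (re_ext a).
by apply: (re_ext b) => r; rewrite PQ.
Qed.

Lemma dec_subst P (s : nat -> env -> nat) :
  dec P -> (forall k, rf (s k)) -> dec (fun r => P (fun k => s k r)).
Proof. by move=> [a b] Hs; split; [apply: re_subst a Hs|apply: re_subst b Hs]. Qed.

Lemma dec_app (P : nat -> env -> Prop) g : dec (fun r => P (r 0) (fun i => r i.+1)) ->
  rf g -> dec (fun r => P (g r) r).
Proof.
move=> HP Hg.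
apply: (dec_subst (s := fun k r => scons (g r) r k) HP) => -[|k] //=.
exact: rf_var.
Qed.

Lemma dec_not P : dec P -> dec (fun r => ~ P r).
Proof. by move=> [a b]; split=> //; apply: (re_ext a) => r; rewrite notK. Qed.

Lemma dec_and P Q : dec P -> dec Q -> dec (fun r => P r /\ Q r).
Proof.
move=> [a b] [c d]; split; first exact: re_and.
by apply: (re_ext (re_or b d)) => r; rewrite not_andP.
Qed.

Lemma dec_lt f g : rf f -> rf g -> dec (fun r => f r < g r).
Proof.
move=> Hf Hg; split; first exact: re_lt.
apply: (re_ext (re_lt Hg (rf_succ Hf))) => r.
by rewrite ltnS leqNgt; split=> /negP.
Qed.

Lemma dec_eq f g : rf f -> rf g -> dec (fun r => f r = g r).
Proof.
move=> Hf Hg; split; first exact: re_eq.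
apply: (re_ext (re_or (re_lt Hf Hg) (re_lt Hg Hf))) => r.
split=> [[] H e|ne]; [by rewrite e ltnn in H|by rewrite e ltnn in H|].
by case: (ltngtP (f r) (g r)) ne => // H _; [left|right].
Qed.

(** Post's theorem: of the searches for [P] and for its negation exactly one succeeds. *)
Lemma rf_dec P : dec P -> rf (fun r => nat_of_bool `[< P r >]).
Proof.
move=> [a b].
apply: (@rf_graph _ (fun y r => (P r /\ y = 1) \/ (~ P r /\ y = 0))).
  apply: re_or; apply: re_and; try by apply: re_eq (rf_const _); apply: rf_var.
    by apply: (re_subst (s := fun k r => r k.+1) a) => k; apply: rf_var.
  by apply: (re_subst (s := fun k r => r k.+1) b) => k; apply: rf_var.
move=> y r; case: asboolP => Pr; split=> [|->]; [by case=> [[]|[]]|by left|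
  by case=> [[]|[]]|by right].
Qed.

Lemma dec_rf P : rf (fun r => nat_of_bool `[< P r >]) -> dec P.
Proof.
move=> H; apply: (dec_ext (dec_eq H (rf_const 1))) => r.
by case: asboolP => Pr; split.
Qed.

Lemma rf_if P f g : dec P -> rf f -> rf g ->
  rf (fun r => if `[< P r >] then f r else g r).
Proof.
move=> dP Hf Hg.
apply: (@rf_ext (fun r => `[< P r >] * f r + (1 - `[< P r >]) * g r)).
  apply: rf_add; apply: rf_mul => //; first exact: rf_dec.
  by apply: rf_sub; [apply: rf_const|apply: rf_dec].
by move=> r; case: asboolP => _; rewrite !(mul1n, mul0n, addn0, add0n).
Qed.

(** * Computable families of finite sets *)

Lemma hf_mem_lt x a : hf_mem x a -> x < a.
Proof.
rewrite /hf_mem ltnNge => H; apply/negP => ax; move: H.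
by rewrite divn_small // (leq_ltn_trans ax) // ltn_expl.
Qed.

(** Quotient and remainder are searched for instead of computed, so only sums, products and powers
    of 2 have to be computable. *)
Lemma hf_mem_digit x y (b : bool) :
  hf_mem x y = b <-> exists q s, s < 2 ^ x /\ y = (q + q + b) * 2 ^ x + s.
Proof.
split=> [<-|[q [s [lt ->]]]].
  exists (y %/ 2 ^ x)./2, (y %% 2 ^ x); split; first by rewrite ltn_mod expn_gt0.
  by rewrite addnn [_ + _ (hf_mem _ _)]addnC odd_double_half -divn_eq.
by rewrite /hf_mem divnMDl ?expn_gt0 // divn_small // addn0 addnn oddD odd_double; case: b.
Qed.

Lemma dec_mem f g : rf f -> rf g -> dec (fun r => hf_mem (f r) (g r)).
Proof.
move=> Hf Hg.
have H (b : bool) : re (fun r => hf_mem (f r) (g r) = b).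
  apply: (@re_ext (fun r => exists q s, s < 2 ^ f r /\ g r = (q + q + b) * 2 ^ f r + s)).
    apply: (@re_ex (fun q r => exists s, s < 2 ^ f r /\ g r = (q + q + b) * 2 ^ f r + s)).
    apply: (@re_ex (fun s r => s < 2 ^ f (fun i => r i.+1) /\ g (fun i => r i.+1) =
      (r 0 + r 0 + b) * 2 ^ f (fun i => r i.+1) + s)).
    have Hp := rf_exp2 (rf_shift (rf_shift Hf)).
    apply: re_and; first by apply: re_lt => //; apply: rf_var.
    apply: re_eq; first exact: (rf_shift (rf_shift Hg)).
    apply: rf_add (rf_var 0); apply: rf_mul => //.
    by apply: rf_add (rf_const b); apply: rf_add; apply: rf_var.
  by move=> r; apply: iff_sym; apply: hf_mem_digit.
split; first exact: (H true).
by apply: (re_ext (H false)) => r; case: hf_mem; split.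
Qed.

Lemma hf_setK (A : set nat) : finite_set A -> [set x | hf_mem x (hf_set A)] = A.
Proof. by move=> fA; apply/seteqP; split=> x /= /(hf_mem_set _ fA). Qed.

Lemma hf_set_inj (A B : set nat) : finite_set A -> finite_set B ->
  hf_set A = hf_set B -> A = B.
Proof. by move=> fA fB e; rewrite -(hf_setK fA) -(hf_setK fB) e. Qed.

Lemma finite_hf a : finite_set [set x | hf_mem x a].
Proof. by apply: (sub_finite_set _ (finite_II a)) => x /=; apply: hf_mem_lt. Qed.

(** Computing the code is stronger than deciding membership: the code bounds the elements, which
    makes quantification over the set effective. *)
Definition fin (A : env -> set nat) : Prop :=
  (forall r, finite_set (A r)) /\ rf (fun r => hf_set (A r)).

Lemma fin_ext A B : fin A -> (forall r, A r = B r) -> fin B.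
Proof. by move=> fA AB; have <- : A = B by apply: funext. Qed.

Lemma fin_subst A (s : nat -> env -> nat) :
  fin A -> (forall k, rf (s k)) -> fin (fun r => A (fun k => s k r)).
Proof. by move=> [a b] Hs; split=> // ; apply: (rf_subst b Hs). Qed.

Lemma fin_shift A : fin A -> fin (fun r => A (fun i => r i.+1)).
Proof. by move=> fA; apply: (fin_subst (s := fun k r => r k.+1) fA) => k; apply: rf_var. Qed.

Lemma fin_app (A : nat -> env -> set nat) g : fin (fun r => A (r 0) (fun i => r i.+1)) ->
  rf g -> fin (fun r => A (g r) r).
Proof.
move=> HA Hg.
apply: (fin_subst (s := fun k r => scons (g r) r k) HA) => -[|k] //=.
exact: rf_var.
Qed.

Lemma dec_fin A f : fin A -> rf f -> dec (fun r => A r (f r)).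
Proof.
move=> [fA rA] rff; apply: (dec_ext (dec_mem rff rA)) => r.
exact: hf_mem_set.
Qed.

Lemma re_all_in A (P : nat -> env -> Prop) : fin A ->
  re (fun r => P (r 0) (fun i => r i.+1)) -> re (fun r => forall x, A r x -> P x r).
Proof.
move=> fA reP.
apply: (@re_ext (fun r => forall x, x < hf_set (A r) -> ~ A r x \/ P x r)).
  apply: (@re_all_lt _ (fun x r => ~ A r x \/ P x r)); first by case: fA.
  by apply: re_or => //; have [_] := dec_fin (fin_shift fA) (rf_var 0).
move=> r; split=> H x; last by move=> _; case: (EM (A r x)) => [/H|]; [right|left].
move=> Ax; case: (H x) => //; apply: hf_mem_lt.
by apply/hf_mem_set => //; case: fA.
Qed.

(** The set [A r] is found by searching for a code all of whose elements are in
    [A r] and which the test [L] accepts. *)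
Lemma fin_intro A (L : nat -> env -> Prop) : (forall r, finite_set (A r)) ->
  re (fun r => A (fun i => r i.+1) (r 0)) -> re (fun r => L (r 0) (fun i => r i.+1)) ->
  (forall r, L (hf_set (A r)) r) ->
  (forall r b, (forall x, hf_mem x b -> A r x) -> L b r ->
     forall x, A r x -> hf_mem x b) -> fin A.
Proof.
move=> fA reA reL LA LS; split=> //.
apply: (@rf_graph _ (fun b r => (forall x, hf_mem x b -> A r x) /\ L b r)).
  apply: re_and => //.
  apply: (@re_ext (fun r => forall x, x < r 0 -> ~ hf_mem x (r 0) \/ A (fun i => r i.+1) x)).
    apply: (@re_all_lt _ (fun x r => ~ hf_mem x (r 0) \/ A (fun i => r i.+1) x)).
      exact: rf_var.
    apply: re_or; first by have [_] := dec_mem (rf_var 0) (rf_var 1).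
    apply: (re_subst (s := fun k r => if k is j.+1 then r j.+2 else r 0) reA).
    by case=> [|k]; apply: rf_var.
  move=> r; split=> H x; last by move=> _; case: (EM (hf_mem x (r 0))) => [/H|]; [right|left].
  by move=> xr; case: (H x) => //; apply: hf_mem_lt.
move=> b r; split=> [[bA Lb]|->]; last by split=> // x /hf_mem_set; apply.
rewrite -[b]hf_set_mem; congr hf_set; apply/seteqP; split=> x; first exact: bA.
exact: LS bA Lb _.
Qed.

Lemma fin_hf f : rf f -> fin (fun r => [set x | hf_mem x (f r)]).
Proof.
move=> Hf; split=> [r|]; first exact: finite_hf.
by apply: (rf_ext Hf) => r; rewrite hf_set_mem.
Qed.

Lemma fin_guard P A : dec P -> fin A -> fin (fun r => [set x | P r /\ A r x]).
Proof.
move=> dP [fA rA]; split=> [r|].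
  by apply: (sub_finite_set _ (fA r)) => x [].
apply: (@rf_ext (fun r => if `[< P r >] then hf_set (A r) else 0)).
  by apply: rf_if => //; apply: rf_const.
move=> r; case: asboolP => Pr.
  by congr hf_set; apply/seteqP; split=> // x [].
(* The default value 0 is the code of the empty set. *)
rewrite -[LHS]hf_set_mem; congr hf_set; apply/seteqP; split=> x; last by case.
by rewrite /= /hf_mem div0n.
Qed.

Lemma fin_set1 f : rf f -> fin (fun r => [set f r]).
Proof.
move=> Hf; apply: (@fin_intro _ (fun b r => hf_mem (f r) b)).
- by move=> r; apply: finite_set1.
- by apply: re_eq; [apply: rf_var|apply: rf_shift].
- by have [] := dec_mem (rf_shift Hf) (rf_var 0).
- by move=> r; apply/hf_mem_set => //; apply: finite_set1.
- by move=> r b _ H x ->.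
Qed.

Lemma fin_bigcup A (B : nat -> env -> set nat) : fin A ->
  fin (fun r => B (r 0) (fun i => r i.+1)) -> fin (fun r => \bigcup_(y in A r) B y r).
Proof.
move=> fA fB.
have finB r y : finite_set (B y r) by have [/(_ (scons y r))] := fB.
have finU r : finite_set (\bigcup_(y in A r) B y r).
  by apply: bigcup_finite => //; case: fA.
apply: (@fin_intro _ (fun b r => forall y, A r y -> forall x, B y r x -> hf_mem x b)) => //.
- apply: (@re_ext (fun r => exists y, A (fun i => r i.+1) y /\ B y (fun i => r i.+1) (r 0))).
    apply: (@re_ex (fun y r => A (fun i => r i.+1) y /\ B y (fun i => r i.+1) (r 0))).
    apply: re_and; first by have [] := dec_fin (fin_shift (fin_shift fA)) (rf_var 0).
    have fB' : fin (fun r => B (r 0) (fun i => r i.+2)).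
      apply: (fin_subst (s := fun k r => if k is j.+1 then r j.+2 else r 0) fB).
      by case=> [|k]; apply: rf_var.
    by have [] := dec_fin fB' (rf_var 1).
  by move=> r; split=> [[y [Ay By]]|[y Ay By]]; exists y.
- apply: (@re_all_in _ (fun y r => forall x, B y (fun i => r i.+1) x -> hf_mem x (r 0))).
    exact: fin_shift.
  apply: (@re_all_in _ (fun x r => hf_mem x (r 1))).
    apply: (fin_subst (s := fun k r => if k is j.+1 then r j.+2 else r 0) fB).
    by case=> [|k]; apply: rf_var.
  by have [] := dec_mem (rf_var 0) (rf_var 2).
- by move=> r y Ay x Bx; apply/hf_mem_set => //; exists y.
- by move=> r b _ H x [y Ay]; apply: H.
Qed.

Lemma fin_setU A B : fin A -> fin B -> fin (fun r => A r `|` B r).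
Proof.
move=> fA fB; have [a _] := fA; have [b _] := fB.
have f r : finite_set (A r `|` B r) by rewrite finite_setU.
apply: (@fin_intro _ (fun b r => (forall x, A r x -> hf_mem x b) /\
    (forall x, B r x -> hf_mem x b))) => //.
- by apply: re_or; [have [] := dec_fin (fin_shift fA) (rf_var 0)|
    have [] := dec_fin (fin_shift fB) (rf_var 0)].
- by apply: re_and; apply: (@re_all_in _ (fun x r => hf_mem x (r 0)));
    try exact: fin_shift; have [] := dec_mem (rf_var 0) (rf_var 1).
- by move=> r; split=> x H; apply/hf_mem_set => //; [left|right].
- by move=> r c _ [H1 H2] x []; [apply: H1|apply: H2].
Qed.

Lemma fin_sep A (P : nat -> env -> Prop) : fin A ->
  dec (fun r => P (r 0) (fun i => r i.+1)) -> fin (fun r => [set x | A r x /\ P x r]).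
Proof.
move=> fA dP.
apply: (@fin_ext (fun r => \bigcup_(y in A r) [set x | P y r /\ [set y] x])).
  by apply: fin_bigcup => //; apply: fin_guard => //; apply: fin_set1; apply: rf_var.
move=> r; apply/seteqP; split=> [x [y Ay [Py ->]]|x [Ax Px]] //.
by exists x.
Qed.

Lemma rf_hf_pair f g : rf f -> rf g -> rf (fun r => hf_pair (f r) (g r)).
Proof.
move=> Hf Hg.
have [_ H1] := fin_set1 Hf; have [_ H2] := fin_setU (fin_set1 Hf) (fin_set1 Hg).
by have [] := fin_setU (fin_set1 H1) (fin_set1 H2).
Qed.

Lemma rf_hf_list (I : Type) (s : seq I) (F : I -> env -> nat) : (forall i, rf (F i)) ->
  rf (fun r => hf_list [seq F i r | i <- s]).
Proof.
move=> H; elim: s => [|i s IH]; first exact: rf_const.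
exact: rf_hf_pair.
Qed.

(** * Recursively defined sets, components and tuples *)

(** Primitive recursion runs on codes: [T] receives the preceding stage decoded from a number, and
    decoding is exact because all stages are finite. *)
Lemma fin_rec (S : nat -> env -> set nat) A (T : nat -> set nat -> env -> set nat) h :
  rf h -> fin A ->
  fin (fun r => T (r 0) [set x | hf_mem x (r 1)] (fun i => r i.+2)) ->
  (forall r, S 0 r = A r) -> (forall k r, S k.+1 r = T k (S k r) r) ->
  fin (fun r => S (h r) r).
Proof.
move=> Hh [fA rA] [fT rT] S0 SS.
have fS k r : finite_set (S k r).
  elim: k => [|k IH]; first by rewrite S0.
  rewrite SS -(hf_setK IH); exact: (fT (scons k (scons (hf_set (S k r)) r))).
split=> //.
apply: (@rf_ext (fun r => prec (hf_set (A r))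
  (fun k z => hf_set (T k [set x | hf_mem x z] r)) (h r))).
  exact: (@rf_prec _ _ (fun k z r => hf_set (T k [set x | hf_mem x z] r))).
by move=> r; elim: (h r) => [|k IH] /=; rewrite ?S0 // IH hf_setK // SS.
Qed.

Lemma fin_walk (E : nat -> nat -> Prop) h f : rf h -> rf f -> fin (fun r => E (r 0)) ->
  fin (fun r => walk E (h r) (f r)).
Proof.
move=> Hh Hf fE.
apply: (@fin_rec (fun k r => walk E k (f r)) (fun r => [set f r])
  (fun _ B _ => \bigcup_(y in B) E y)) => //.
- exact: fin_set1.
- apply: fin_bigcup; first by apply: fin_hf; apply: rf_var.
  by apply: (@fin_app (fun x _ => E x)) (rf_var 0).
- move=> r; apply/seteqP; split=> [y w|y ->]; last exact: walk0.
  by inversion w.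
- move=> k r; apply/seteqP; split=> [y w|y [x w e]]; last exact: walkS w e.
  by inversion w; subst; exists y0.
Qed.

(** No bound on the length of walks is available. A finite subset of the component that contains the
    start and is closed under [E] is the whole component, and this can be tested. *)
Lemma fin_component (E : nat -> nat -> Prop) f : rf f -> fin (fun r => E (r 0)) ->
  (forall x, finite_set (component E x)) -> fin (fun r => component E (f r)).
Proof.
move=> Hf fE fC.
apply: (@fin_intro _ (fun b r => hf_mem (f r) b /\
    forall y, hf_mem y b -> forall z, E y z -> hf_mem z b)) => //.
- apply: (@re_ex (fun k r => walk E k (f (fun i => r i.+1)) (r 0))).
  by have [] := dec_fin (fin_walk (rf_var 0) (rf_shift (rf_shift Hf)) fE) (rf_var 1).
- apply: re_and; first by have [] := dec_mem (rf_shift Hf) (rf_var 0).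
  apply: (@re_all_in (fun r => [set y | hf_mem y (r 0)])
    (fun y r => forall z, E y z -> hf_mem z (r 0))); first by apply: fin_hf; apply: rf_var.
  apply: (@re_all_in (fun r => E (r 0)) (fun z r => hf_mem z (r 1))) => //.
  by have [] := dec_mem (rf_var 0) (rf_var 2).
- move=> r; split; first by apply/hf_mem_set => //; exists 0; apply: walk0.
  move=> y /(hf_mem_set _ (fC _)) [k w] z e; apply/hf_mem_set => //.
  by exists k.+1; apply: walkS w e.
- move=> r b _ [H0 HS] y [k w]; elim: w H0 => [x|{}k x u v _ IH e] // H0.
  exact: HS (IH H0) _ e.
Qed.

Lemma mkseqS T (f : nat -> T) m : mkseq f m.+1 = f 0 :: mkseq (fun i => f i.+1) m.
Proof. by rewrite /mkseq /= -[1]/(1 + 0) iotaDl -map_comp. Qed.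

(** The entries of the sequence are the first [m] variables, so sequences need not be coded; the
    proof is [m] nested unions over [A]. *)
Lemma fin_tuples m A (B : seq nat -> env -> set nat) : fin A ->
  fin (fun r => B (mkseq r m) (fun i => r (m + i))) ->
  fin (fun r => [set z | exists s, [/\ size s = m, forall x, x \in s -> A r x & B s r z]]).
Proof.
move=> fA; elim: m B => [|m IH] B fB.
  apply: (fin_ext fB) => r; apply/seteqP; split=> z; first by exists [::].
  by case=> -[|x s] [].
apply: (@fin_ext (fun r => [set z | exists s, [/\ size s = m, forall x, x \in s -> A r x &
    (\bigcup_(a in A r) B (a :: s) r) z]])); last first.
  move=> r; apply/seteqP; split=> z [s].
    move=> [ss sA [a Aa Bz]]; exists (a :: s); split=> //=; first by rewrite ss.
    by move=> x; rewrite inE => /orP [/eqP ->|/sA].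
  case: s => [|a s] [//= [ss] sA Bz]; exists s; split=> //.
    by move=> x xs; apply: sA; rewrite inE xs orbT.
  by exists a => //; apply: sA; rewrite inE eqxx.
apply: (IH (fun s r => \bigcup_(a in A r) B (a :: s) r)).
apply: (@fin_bigcup _ (fun a r => B (a :: mkseq r m) (fun i => r (m + i)))).
  by apply: (fin_subst (s := fun k r => r (m + k)) fA) => k; apply: rf_var.
by apply: (fin_ext fB) => r; rewrite mkseqS; congr B.
Qed.

(** * Cardinality of coded sets *)

Definition hf_card (b : HF) : nat := \sum_(x < b) hf_mem x b.

Lemma hf_card_size b : hf_card b = size [seq x <- iota 0 b | hf_mem x b].
Proof.
rewrite /hf_card -(big_mkord xpredT (fun x => nat_of_bool (hf_mem x b))).
by rewrite /index_iota subn0 size_filter -sum1_count [RHS]big_mkcond.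
Qed.

Lemma hf_card_set (A : set nat) k : A #= `I_k -> hf_card (hf_set A) = k.
Proof.
move=> Ak; have fA : finite_set A by exists k.
rewrite hf_card_size -(card_fset_set Ak).
apply/perm_size/uniq_perm; [by rewrite filter_uniq ?iota_uniq|exact: fset_uniq|].
move=> y; rewrite mem_filter mem_iota /= add0n -[RHS]/(y \in fset_set A) in_fset_set //.
apply/andP/idP => [[/(hf_mem_set _ fA) Ay _]|]; rewrite inE //.
by move=> /(hf_mem_set _ fA) H; split=> //; apply: hf_mem_lt.
Qed.

(** The completeness certificate for neighbourhoods: a subset with as many elements as the finite
    set [A] is [A]. *)
Lemma hf_card_sub (A : set nat) k b : A #= `I_k ->
  (forall x, hf_mem x b -> A x) -> hf_card b = k -> forall x, A x -> hf_mem x b.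
Proof.
move=> Ak bA cb x Ax.
have fA : finite_set A by exists k.
pose s := [seq x <- iota 0 b | hf_mem x b].
have us : uniq s by rewrite filter_uniq // iota_uniq.
have sA : {subset s <= enum_fset (fset_set A)}.
  move=> y; rewrite mem_filter => /andP [yb _].
  by rewrite -[_ \in enum_fset _]/(y \in fset_set A) in_fset_set // inE; apply: bA.
have ss : size s = k by rewrite -hf_card_size.
have [|_ e] := uniq_min_size us sA; first by rewrite ss -(card_fset_set Ak).
have : x \in s.
  by rewrite e -[_ \in enum_fset _]/(x \in fset_set A) in_fset_set // inE.
by rewrite mem_filter => /andP [].
Qed.

Lemma rf_hf_card f : rf f -> rf (fun r => hf_card (f r)).
Proof.
move=> Hf; apply: (@rf_sum _ (fun x r => hf_mem x (f r))) => //.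
apply: (@rf_ext (fun r => nat_of_bool `[< hf_mem (r 0) (f (fun i => r i.+1)) >])).
  by apply: rf_dec; apply: dec_mem; [apply: rf_var|apply: rf_shift].
by move=> r; rewrite asboolb.
Qed.

(** * Passage between [computable] and [rf] *)

Lemma computable_rf n (f : n.-tuple HF -> HF) :
  computable f -> rf (fun r => f (env_tuple n r)).
Proof. by move=> [p H]; exists n, p. Qed.

Lemma computable_fun_rf f : computable_fun f -> rf (fun r => f (r 0)).
Proof. by move/computable_rf => H; apply: (rf_ext H) => r; rewrite /thead tnth_mktuple. Qed.

Lemma rf_computable_fun f : rf (fun r => f (r 0)) -> computable_fun f.
Proof.
move=> [n [p H]].
(* All variables but the first are fed 0; the value does not depend on them. *)
exists (Comp p (fun i : 'I_n => if val i == 0 then Proj ord0 else Zero 1)) => t.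
apply: eval_Comp (H (scons (thead t) (fun=> 0))) => i; rewrite tnth_mktuple.
case: i => -[|i] lti /=; last exact: eval_Zero.
exact: eval_Proj.
Qed.

(** * Closed embeddings of relations *)

Section Embedding.
Variables (V V' : Type) (h : V -> V').

(** Besides preserving edges, this forbids [E']-edges that leave the image of [h], so walks starting
    in the image lift back to [V]. *)
Definition embeds (E : V -> V -> Prop) (E' : V' -> V' -> Prop) : Prop :=
  forall x, E' (h x) = h @` E x.

Variables (E : V -> V -> Prop) (E' : V' -> V' -> Prop).
Hypothesis EE' : embeds E E'.

Lemma embeds_walk k : embeds (walk E k) (walk E' k).
Proof.
move=> x; elim: k => [|k IH]; apply/seteqP; split=> y.
- by move=> w; inversion w; exists x => //; apply: walk0.
- by case=> z w <-; inversion w; apply: walk0.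
- move=> w; inversion w as [|? ? u ? w' e]; subst.
  have : walk E' k (h x) u by [].
  rewrite IH => -[v wv hv]; move: e; rewrite -hv EE' => -[z vz <-].
  by exists z => //; apply: walkS wv vz.
- case=> z w <-; inversion w as [|? ? u ? w' e]; subst.
  apply: (@walkS _ _ _ _ (h u)); first by rewrite IH; exists u.
  by rewrite EE'; exists z.
Qed.

Lemma embeds_dist r : embeds (dist_le E r) (dist_le E' r).
Proof.
move=> x; apply/seteqP; split=> [y [k kr]|_ [y [k kr w] <-]].
  by rewrite embeds_walk => -[z w <-]; exists z => //; exists k.
by exists k => //; rewrite embeds_walk; exists y.
Qed.

Lemma embeds_component x : component E' (h x) = h @` component E x.
Proof.
apply/seteqP; split=> [y [k]|_ [y [k w] <-]].
  by rewrite embeds_walk => -[z w <-]; exists z => //; exists k.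
by exists k; rewrite embeds_walk; exists y.
Qed.

End Embedding.

(** The relation in [block x] depends on the part of [x]. This one is the same for all [x] and has
    the same components, so [fin_component] can be applied to it. *)
Definition level_step V (T : Type) (p : V -> T) (E : V -> V -> Prop) (x y : V) : Prop :=
  p x = p y /\ E x y.

Lemma component_induced V (T : Type) (p : V -> T) (E : V -> V -> Prop) x :
  component (induced [set y | p y = p x] E) x = component (level_step p E) x.
Proof.
apply/seteqP; split=> y [k w]; exists k.
  elim: w => [a|j a b c _ IH [pb pc e]]; first exact: walk0.
  by apply: walkS IH _; split=> //; rewrite pb pc.
suff [] : walk (induced [set y | p y = p x] E) k x y /\ p y = p x by [].
elim: w => [a|j a b c _ [IH pb] [pbc e]]; first by split=> //; apply: walk0.
by split; [apply: walkS IH _; split=> //=|]; rewrite -pbc.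
Qed.

Section BlockBall.
Variables (L : language) (V : Type) (G : sgraph L V) (s r : nat) (part : V -> 'I_s.+1).

Lemma block_ball0 x : block_ball G r part 0 (block G r part x) = block G r part x.
Proof.
apply/seteqP; split=> [y [C [_ [k]]]|y xy].
  by rewrite leqn0 => /eqP -> w; inversion w.
by exists (block G r part x); split=> //; [exists x|exists 0 => //; apply: walk0].
Qed.

(** Describes balls in the graph of blocks through vertices alone, so that sets of sets never have
    to be computed. *)
Lemma block_ballS n x : block_ball G r part n.+1 (block G r part x) =
  \bigcup_(y in block_ball G r part n (block G r part x))
    \bigcup_(z in dist_le (adj G) r y) block G r part z.
Proof.
apply/seteqP; split=> [y [C [bC [k kn w] Cy]]|y [a [C [[c _ cC] [k kn w] Ca]]]].
  move: kn; rewrite leq_eqVlt => /orP [/eqP ek|kn]; last first.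
    exists y; first by exists C; split=> //; exists k.
    by exists y; [exists 0 => //; apply: walk0|apply: block_refl].
  subst k; inversion w as [|? ? B ? w' [bB _ _ [a [b [Ba Cb ab]]]]]; subst.
  exists a; first by exists B; split=> //; exists n.
  by exists b => //; case: bC Cb Cy => c _ <-; apply: block_sub.
case=> b ab bY; subst C.
exists (block G r part b); split=> //; first by exists b.
(* [block_adj] relates only distinct blocks, so a jump inside one block adds no step to the walk. *)
have [e|ne] := EM (block G r part c = block G r part b).
  by exists k; [apply: leqW|rewrite -e].
exists k.+1 => //; apply: walkS w _; split=> //; [by exists c|by exists b|].
by exists a, b; split=> //; apply: block_refl.
Qed.

End BlockBall.

(** * The partition of a highly computable graph *)

Lemma sval_inj T (P : T -> Prop) : injective (@sval T P).
Proof. by move=> [a p] [b q] /= e; subst b; congr exist; apply: Prop_irrelevance. Qed.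

Lemma sum_ltn m N : m <= N -> \sum_(k < N) (k < m) = m.
Proof.
move=> mN; rewrite (bigID (fun k : 'I_N => k < m)) /= [X in _ + X]big1 => [|i /negbTE -> //].
rewrite addn0 (eq_bigr (fun=> 1)) => [|i -> //].
by rewrite -(big_ord_widen _ (fun=> 1) mN) sum_nat_const card_ord muln1.
Qed.

Section Partition.
Variables (L : language) (D : set HF) (G : sgraph L {x | D x}) (d : nat).

Definition edge (a b : HF) : Prop :=
  exists x y, [/\ adj G x y, sval x = a & sval y = b].

Lemma embeds_edge : embeds sval (adj G) edge.
Proof.
move=> x; apply/seteqP; split=> [b [u [v [uv /sval_inj <- <-]]]|_ [y xy <-]].
  by exists v.
by exists x, y.
Qed.

Lemma edge_dom a b : edge a b -> D a /\ D b.
Proof. by move=> [[x Dx] [[y Dy] [_ /= <- <-]]]. Qed.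

Lemma edge_sym a b : edge a b -> edge b a.
Proof. by move=> [x [y [xy ex ey]]]; exists y, x; split=> //; apply: adj_sym. Qed.

Lemma dist_dom a b : dist_le edge d a b -> a <> b -> D a /\ D b.
Proof.
case=> k _ w; elim: w => [x|{}k x y z _ IH e] // _.
have [Dy Dz] := edge_dom e; split=> //.
by have [->|/IH []] := EM (x = y).
Qed.

Lemma dist_sym a b : dist_le edge d a b -> dist_le edge d b a.
Proof. by case=> k kd w; exists k => //; apply: walk_sym w; apply: edge_sym. Qed.

(** Every vertex [j] enters at stage [j.+1], and a stage contains the
    [d]-neighbourhood of the preceding one; so vertices at distance at most [d]
    have levels that differ by at most one, and equal levels if these have the
    same parity. *)
Fixpoint cover (k : nat) : set HF :=
  if k is j.+1 then
    (\bigcup_(y in cover j) dist_le edge d y) `|` [set x | D j /\ [set j] x]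
  else set0.

(** For [x] in [D] this is the first stage containing [x]: stages increase and [x] has entered by
    stage [x.+1], so counting the earlier stages that miss it suffices. The count is bounded, hence
    total even off [D]. *)
Definition level (x : HF) : nat := \sum_(k < x.+1) nat_of_bool `[< ~ cover k x >].

Lemma cover_sub j k : j <= k -> cover j `<=` cover k.
Proof.
move=> /subnK <-; elim: (k - j) => [|i IH] // x /IH cx; rewrite addSn /=.
by left; exists x => //; exists 0 => //; apply: walk0.
Qed.

Lemma coverP k x : D x -> cover k x <-> level x <= k.
Proof.
move=> Dx.
have ex : exists k, `[< cover k x >] by exists x.+1; apply/asboolP; right.
have [m /asboolP cm mmin] := ex_minnP ex.
have cP j : cover j x <-> m <= j.
  by split=> [cj|mj]; [apply: mmin; apply/asboolP|apply: cover_sub mj _ cm].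
suff -> : level x = m by [].
rewrite /level -[RHS](@sum_ltn m x.+1); last by apply/cP; right.
apply: eq_bigr => j _; congr nat_of_bool; apply/asboolP/idP; rewrite cP ltnNge.
  by move/negP.
by move/negP.
Qed.

Lemma level_dist x y : D x -> D y -> dist_le edge d x y -> level y <= (level x).+1.
Proof.
move=> Dx Dy xy; apply/(coverP _ Dy); left; exists x => //.
exact/(coverP _ Dx).
Qed.

Definition step (a b : HF) : Prop :=
  level_step (fun x => odd (level x)) (power edge d) a b.

Lemma step_level a b : step a b -> [/\ D a, D b & level a = level b].
Proof.
move=> [o [ab dab]]; have [Da Db] := dist_dom dab ab; split=> //.
have := level_dist Da Db dab; have := level_dist Db Da (dist_sym dab).
move: o; case: (ltngtP (level a) (level b)) => // lt o h1 h2.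
  have e : level b = (level a).+1 by apply/eqP; rewrite eqn_leq h2.
  by move: o; rewrite e /=; case: odd.
have e : level a = (level b).+1 by apply/eqP; rewrite eqn_leq h1.
by move: o; rewrite e /=; case: odd.
Qed.

Definition part (x : {x | D x}) : 'I_2 := inord (odd (level (sval x))).

Lemma part_eq x y : part x = part y <-> odd (level (sval x)) = odd (level (sval y)).
Proof.
split=> [/(congr1 val)|e]; last by rewrite /part e.
by rewrite /= !inordK; [case: odd; case: odd|case: odd|case: odd].
Qed.

Lemma embeds_step : embeds sval (level_step part (power (adj G) d)) step.
Proof.
move=> x; apply/seteqP; split=> [b [o [ne]]|_ [y [pxy [ne dxy]] <-]].
  rewrite (embeds_dist embeds_edge) => -[y dxy yb]; subst b; exists y => //.
  by split; [apply/part_eq|split=> // e; apply: ne; rewrite e].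
split; first exact/part_eq.
by split=> [/sval_inj //|]; rewrite (embeds_dist embeds_edge); exists y.
Qed.

Lemma block_component x : component step (sval x) = sval @` block G d part x.
Proof. by rewrite (embeds_component embeds_step) /block component_induced. Qed.

Hypothesis hG : highly_computable G.

Lemma dec_dom f : rf f -> dec (fun r => D (f r)).
Proof.
move=> Hf; case: hG => H _ _ _; apply: (@dec_app (fun x _ => D x)) Hf.
exact: dec_rf (computable_fun_rf (f := fun x => nat_of_bool `[< D x >]) H).
Qed.

Lemma dec_edge f g : rf f -> rf g -> dec (fun r => edge (f r) (g r)).
Proof.
move=> Hf Hg; case: hG => _ /computable_rf /dec_rf H _ _.
apply: (dec_ext (dec_subst (s := fun k r => if k is 0 then f r else g r) H _)).
  by case.
move=> r; split=> [[x [y [xy e]]]|[x [y [xy ex ey]]]]; exists x, y; split=> //.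
- by have := congr1 (fun t => tnth t ord0) e; rewrite tnth_mktuple.
- by have := congr1 (fun t => tnth t ord_max) e; rewrite tnth_mktuple.
apply: eq_from_tnth => i; rewrite tnth_mktuple ex ey.
by case: i => -[|[|i]].
Qed.

(** The place where computable degrees enter: neighbours are collected until their number is the
    degree. The degree function says nothing off [D], where the neighbourhood is empty, so this case
    is split off. *)
Lemma fin_edge : fin (fun r => edge (r 0)).
Proof.
case: (hG) => _ _ _ [f [Hf degf]].
have cE x : D x -> edge x #= `I_(f x).
  move=> Dx; rewrite -[x]/(sval (exist _ x Dx)) embeds_edge.
  apply: card_eq_trans (degf (exist _ x Dx)).
  by apply: inj_card_eq => u v _ _; apply: sval_inj.
have E0 x : ~ D x -> edge x = set0.
  by move=> nD; apply/seteqP; split=> // y /edge_dom [].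
have fE x : finite_set (edge x).
  by have [Dx|/E0 ->] := EM (D x); [exists (f x); apply: cE|apply: finite_set0].
apply: (@fin_intro _ (fun b r => ~ D (r 0) \/ hf_card b = f (r 0))).
- by move=> r; apply: fE.
- by have [] := dec_edge (rf_var 1) (rf_var 0).
- apply: re_or; first by have [_] := dec_dom (rf_var 1).
  apply: re_eq; first by apply: rf_hf_card; apply: rf_var.
  exact: (rf_shift (computable_fun_rf Hf)).
- move=> r; have [Dx|] := EM (D (r 0)); [right|by left].
  by apply: hf_card_set; apply: cE.
- move=> r b bA [nD|cb] x; first by rewrite E0.
  have [Dx|/E0 -> //] := EM (D (r 0)).
  exact: (hf_card_sub (cE _ Dx) bA cb).
Qed.

Lemma fin_dist f : rf f -> fin (fun r => dist_le edge d (f r)).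
Proof.
move=> Hf.
apply: (@fin_ext (fun r => \bigcup_(k in `I_d.+1) walk edge k (f r))); last first.
  by move=> r; apply/seteqP; split=> y [k kd w]; exists k.
apply: (@fin_bigcup _ (fun k r => walk edge k (f r))).
  by split=> [r|]; [apply: finite_II|apply: rf_const].
by apply: fin_walk fin_edge; [apply: rf_var|apply: rf_shift].
Qed.

Lemma fin_cover f : rf f -> fin (fun r => cover (f r)).
Proof.
move=> Hf; apply: (@fin_rec (fun k _ => cover k) (fun=> set0) (fun k B _ =>
  (\bigcup_(y in B) dist_le edge d y) `|` [set x | D k /\ [set k] x])) => //.
  by split=> [r|]; [apply: finite_set0|apply: rf_const].
apply: fin_setU.
  apply: (@fin_bigcup (fun r => [set x | hf_mem x (r 1)]) (fun y _ => dist_le edge d y)).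
    by apply: fin_hf; apply: rf_var.
  by apply: fin_dist; apply: rf_var.
by apply: fin_guard; [apply: dec_dom|apply: fin_set1]; apply: rf_var.
Qed.

Lemma rf_level f : rf f -> rf (fun r => level (f r)).
Proof.
move=> Hf; apply: (@rf_sum _ (fun k r => nat_of_bool `[< ~ cover k (f r) >])).
  exact: rf_succ.
apply: rf_dec; apply: dec_not.
apply: (@dec_fin (fun r => cover (r 0)) (fun r => f (fun i => r i.+1))) (rf_shift Hf).
by apply: fin_cover; apply: rf_var.
Qed.

Lemma dec_odd f : rf f -> dec (fun r => odd (f r)).
Proof.
move=> Hf; apply: (@dec_ext (fun r => hf_mem 0 (f r))).
  by apply: dec_mem Hf; apply: rf_const.
by move=> r; rewrite /hf_mem expn0 divn1.
Qed.

Lemma fin_step f : rf f -> fin (fun r => step (f r)).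
Proof.
(* Equality of parities is phrased as equality of two computable numbers, so that [dec_eq]
   applies. *)
move=> Hf; apply: (@fin_ext (fun r => [set b | dist_le edge d (f r) b /\
    (~ f r = b /\ ((nat_of_bool `[< odd (level (f r)) >]) = `[< odd (level b) >])) ])).
  apply: (@fin_sep _ (fun b r => ~ f r = b /\
    ((nat_of_bool `[< odd (level (f r)) >]) = `[< odd (level b) >]))).
    exact: fin_dist.
  apply: dec_and; first by apply/dec_not/dec_eq; [apply: rf_shift|apply: rf_var].
  by apply: dec_eq; apply: rf_dec; apply: dec_odd; apply: rf_level;
    [apply: rf_shift|apply: rf_var].
move=> r; apply/seteqP; split=> b; rewrite /= !asboolb.
  by move=> [fb [ne o]]; split=> //; move: o; case: odd; case: odd.
by move=> [o [ne fb]]; split=> //; split=> //; congr nat_of_bool.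
Qed.

(** The level is constant along steps, so a component stays inside the finite stage
    [cover (level a)]; the singleton takes care of an [a] outside [D]. *)
Lemma finite_step_component a : finite_set (component step a).
Proof.
apply: (@sub_finite_set _ _ ([set a] `|` cover (level a))); last first.
  rewrite finite_setU; split; first exact: finite_set1.
  by have [/(_ (fun=> level a))] := fin_cover (rf_var 0).
move=> b [k w].
suff : b = a \/ D b /\ level b = level a.
  by case=> [->|[Db <-]]; [left|right; apply/coverP].
elim: w => [x|{}k x y z _ IH e]; [by left|right].
have [_ Dz <-] := step_level e; split=> //.
by case: IH => [->|[]].
Qed.

Lemma part_witness : asi_witness G d part.
Proof.
move=> x; have := finite_step_component (sval x).
rewrite block_component => /finite_preimage H.
apply: (@sub_finite_set _ _ (sval @^-1` (sval @` block G d part x))) => [y xy|].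
  by exists y.
by apply: H => u v _ _; apply: sval_inj.
Qed.

(** The recursion of [block_ballS], carried out on numbers. *)
Fixpoint nball (n : nat) (a : HF) : set HF :=
  if n is m.+1 then
    \bigcup_(y in nball m a) \bigcup_(z in dist_le edge d y) component step z
  else component step a.

Lemma nball_block_ball n x :
  nball n (sval x) = sval @` block_ball G d part n (block G d part x).
Proof.
elim: n => [|n IH] /=; first by rewrite block_ball0 block_component.
rewrite IH block_ballS; apply/seteqP; split=> a.
  case=> _ [y xy <-]; rewrite (embeds_dist embeds_edge) => -[_ [z yz <-]].
  by rewrite block_component => -[w zw <-]; exists w => //; exists y => //; exists z.
case=> w [y xy [z yz zw]] <-; exists (sval y); first by exists y.
exists (sval z); first by rewrite (embeds_dist embeds_edge); exists z.
by rewrite block_component; exists w.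
Qed.

Lemma fin_nball n f : rf f -> fin (fun r => nball n (f r)).
Proof.
have fc g : rf g -> fin (fun r => component step (g r)).
  move=> Hg; apply: fin_component => //; first by apply: fin_step; apply: rf_var.
  exact: finite_step_component.
elim: n f => [|n IH] f Hf /=; first exact: fc.
apply: (@fin_bigcup _ (fun y _ => \bigcup_(z in dist_le edge d y) component step z)).
  exact: IH.
apply: (@fin_bigcup _ (fun z _ => component step z)).
  by apply: fin_dist; apply: rf_var.
by apply: fc; apply: rf_var.
Qed.

End Partition.

(** * Canonical codes of local inputs *)

Lemma hf_pair_inj a b c e : hf_pair a b = hf_pair c e -> a = c /\ b = e.
Proof.
have f1 (x : HF) : finite_set [set x] by apply: finite_set1.
have f2 (x y : HF) : finite_set [set x; y] by rewrite finite_setU.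
move=> /(hf_set_inj (f2 _ _) (f2 _ _)) E.
have E1 x y z : hf_set [set x] = hf_set [set y; z] -> y = x /\ z = x.
  move=> /(hf_set_inj (f1 _) (f2 _ _)) H.
  by split; [have : [set y; z] y by left|have : [set y; z] z by right]; rewrite -H.
have ac : a = c.
  have : [set hf_set [set a]; hf_set [set a; b]] (hf_set [set a]) by left.
  rewrite E => -[/(hf_set_inj (f1 _) (f1 _)) H|/E1 [-> //]].
  by have : [set a] a by []; rewrite H.
subst c; split=> //.
have : [set hf_set [set a]; hf_set [set a; b]] (hf_set [set a; b]) by right.
rewrite E => -[/esym /E1 [_ ba]|].
  subst b.
  have : [set hf_set [set a]; hf_set [set a; e]] (hf_set [set a; e]) by right.
  by rewrite -E => -[/esym /E1 [_ ->]|/(hf_set_inj (f2 _ _) (f2 _ _)) H] //;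
    have : [set a; e] e by [right]; rewrite H => -[].
move=> /(hf_set_inj (f2 _ _) (f2 _ _)) H.
have : [set a; b] b by right.
rewrite H => -[/= ba|//]; subst b.
by have : [set a; e] e by [right]; rewrite -H => -[].
Qed.

(** On a finite [W] this is the increasing bijection onto an initial segment, which is the canonical
    labelling for the numerical order. *)
Definition rank (W : set nat) (y : nat) : nat := \sum_(z < y) nat_of_bool `[< W z >].

Lemma rankS W y : rank W y.+1 = rank W y + `[< W y >].
Proof. by rewrite /rank big_ord_recr. Qed.

Lemma rank_leq W x y : x <= y -> rank W x <= rank W y.
Proof.
by move=> /subnK <-; elim: (y - x) => [|i IH] //; rewrite addSn rankS (leq_trans IH) ?leq_addr.
Qed.

Lemma rank_ltn (W : set nat) x y : W x -> x < y -> rank W x < rank W y.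
Proof.
move=> Wx xy; apply: leq_trans (rank_leq W xy).
by rewrite rankS; case: asboolP => //; rewrite addn1.
Qed.

Lemma rank_mono (W : set nat) x y : W x -> W y -> x < y <-> rank W x < rank W y.
Proof.
move=> Wx Wy; split; first exact: rank_ltn.
by case: (ltngtP x y) => // [yx|->]; rewrite ?ltnn // ltnNge ltnW // rank_ltn.
Qed.

Lemma rank_inj (W : set nat) x y : W x -> W y -> rank W x = rank W y -> x = y.
Proof.
by move=> Wx Wy e; case: (ltngtP x y) => // [/(rank_ltn Wx)|/(rank_ltn Wy)]; rewrite e ltnn.
Qed.

Lemma rank_surj (W : set nat) N k : k < rank W N -> exists2 y, W y & rank W y = k.
Proof.
elim: N => [|N IH]; first by rewrite /rank big_ord0.
rewrite rankS; case: asboolP => WN; last by rewrite addn0.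
rewrite addn1 ltnS leq_eqVlt => /orP [/eqP ->|/IH //].
by exists N.
Qed.

Section Coding.
Variables (L : language) (D : set HF) (G : sgraph L {x | D x}) (d n : nat).
Hypothesis hG : highly_computable G.

Local Notation W := (nball G d n).
Local Notation rk a := (rank (W a)).

Definition nat_srel (i : 'I_(size L)) (s : seq HF) : Prop :=
  exists u : (arity i).-tuple {x | D x}, srel G u /\ s = map sval u.

(** The canonical code of the local input at [a], rebuilt from numbers: each component is a union
    over the ball of guarded singletons, the shape handled by [fin_bigcup], [fin_guard] and
    [fin_tuples]. *)
Definition nat_code (a : HF) : HF :=
  hf_list
    [:: hf_set (\bigcup_(u in W a) [set rk a u]);
        hf_set (\bigcup_(u in W a) \bigcup_(v in W a)
                  [set z | edge G u v /\ [set hf_pair (rk a u) (rk a v)] z]);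
        hf_list [seq hf_set [set z | exists s : seq HF,
                   [/\ size s = arity i, forall x, x \in s -> W a x &
                       [set z | nat_srel i s /\ [set hf_list (map (rk a) s)] z] z]]
                | i <- enum 'I_(size L)];
        hf_set (\bigcup_(u in W a) \bigcup_(v in W a)
                  [set z | u < v /\ [set hf_pair (rk a u) (rk a v)] z]);
        hf_list [seq hf_set (\bigcup_(u in W a)
                   [set z | inord (odd (level G d u)) = i /\ [set rk a u] z])
                | i <- enum 'I_2];
        hf_set (\bigcup_(u in component (step G d) a) [set rk a u])].

Lemma rf_rk f g : rf f -> rf g -> rf (fun r => rk (f r) (g r)).
Proof.
move=> Hf Hg; apply: (@rf_sum _ (fun z r => nat_of_bool `[< W (f r) z >])) => //.
apply: rf_dec.
apply: (@dec_fin (fun r => W (f (fun i => r i.+1))) (fun r => r 0)) (rf_var 0).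
by apply: fin_nball => //; apply: rf_shift.
Qed.

Lemma dec_nat_srel i : dec (fun r => nat_srel i (mkseq r (arity i))).
Proof.
case: hG => _ _ /(_ i) /computable_rf /dec_rf H _.
apply: (dec_ext H) => r.
have vE : val (env_tuple (arity i) r) = mkseq r (arity i).
  by rewrite /= /mkseq -val_enum_ord -map_comp; apply: eq_map.
split=> -[u [su e]]; exists u; split=> //; first by rewrite -vE e.
by apply: val_inj; rewrite vE e.
Qed.

Lemma dec_part f (i : 'I_2) : rf f -> dec (fun r => inord (odd (level G d (f r))) = i).
Proof.
move=> Hf.
apply: (@dec_ext (fun r => nat_of_bool `[< odd (level G d (f r)) >] = i)).
  by apply: dec_eq (rf_const _); apply: rf_dec; apply: dec_odd; apply: rf_level.
move=> r; rewrite asboolb; split=> [e|<-]; last by rewrite inordK //; case: odd.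
by apply: val_inj; rewrite /= inordK //; case: odd.
Qed.

Lemma rf_nat_code : rf (fun r => nat_code (r 0)).
Proof.
have fW k : fin (fun r => W (r k)) by apply: fin_nball => //; apply: rf_var.
have rk1 j k : rf (fun r => rk (r j) (r k)) by apply: rf_rk; apply: rf_var.
have pairs (R : nat -> nat -> Prop) : dec (fun r => R (r 1) (r 0)) ->
    rf (fun r => hf_set (\bigcup_(u in W (r 0)) \bigcup_(v in W (r 0))
                  [set z | R u v /\ [set hf_pair (rk (r 0) u) (rk (r 0) v)] z])).
  move=> dR.
  suff [] : fin (fun r => \bigcup_(u in W (r 0)) \bigcup_(v in W (r 0))
    [set z | R u v /\ [set hf_pair (rk (r 0) u) (rk (r 0) v)] z]) by [].
  apply: (@fin_bigcup _ (fun u r => \bigcup_(v in W (r 0))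
    [set z | R u v /\ [set hf_pair (rk (r 0) u) (rk (r 0) v)] z])) => //.
  apply: (@fin_bigcup _ (fun v r =>
    [set z | R (r 0) v /\ [set hf_pair (rk (r 1) (r 0)) (rk (r 1) v)] z])).
    exact: (fW 1).
  by apply: fin_guard => //; apply: fin_set1; apply: rf_hf_pair; apply: rk1.
rewrite /nat_code {1}/hf_list /=.
apply: rf_hf_pair; [|apply: rf_hf_pair; [|apply: rf_hf_pair; [|apply: rf_hf_pair;
  [|apply: rf_hf_pair; [|apply: rf_hf_pair; [|exact: rf_const]]]]]].
- suff [] : fin (fun r => \bigcup_(u in W (r 0)) [set rk (r 0) u]) by [].
  apply: (@fin_bigcup _ (fun u r => [set rk (r 0) u])) => //.
  by apply: fin_set1; apply: rk1.
- by apply: pairs; apply: dec_edge => //; apply: rf_var.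
- apply: (@rf_hf_list _ _ (fun i r => hf_set [set z | exists s : seq HF,
     [/\ size s = arity i, forall x, x \in s -> W (r 0) x &
         [set z | nat_srel i s /\ [set hf_list (map (rk (r 0)) s)] z] z]])) => i.
  suff [] : fin (fun r => [set z | exists s : seq HF,
     [/\ size s = arity i, forall x, x \in s -> W (r 0) x &
         [set z | nat_srel i s /\ [set hf_list (map (rk (r 0)) s)] z] z]]) by [].
  apply: (@fin_tuples _ _ (fun s r =>
    [set z | nat_srel i s /\ [set hf_list (map (rk (r 0)) s)] z])) => //.
  apply: fin_guard; first exact: dec_nat_srel.
  apply: fin_set1; rewrite /mkseq.
  (* The tuple occupies the first [arity i] variables, so the center of the ball is now variable
     [arity i + 0]. *)
  apply: (@rf_ext (fun r => hf_list [seq rk (r (arity i + 0)) (r j) | j <- iota 0 (arity i)])).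
    by apply: (@rf_hf_list _ _ (fun j r => rk (r (arity i + 0)) (r j))) => j; apply: rk1.
  by move=> r; rewrite -map_comp.
- by apply: pairs; apply: dec_lt; apply: rf_var.
- apply: (@rf_hf_list _ _ (fun i r => hf_set (\bigcup_(u in W (r 0))
    [set z | inord (odd (level G d u)) = i /\ [set rk (r 0) u] z]))) => i.
  suff [] : fin (fun r => \bigcup_(u in W (r 0))
    [set z | inord (odd (level G d u)) = i /\ [set rk (r 0) u] z]) by [].
  apply: (@fin_bigcup _ (fun u r =>
    [set z | inord (odd (level G d u)) = i /\ [set rk (r 0) u] z])) => //.
  by apply: fin_guard; [apply: dec_part; apply: rf_var|apply: fin_set1; apply: rk1].
- suff [] : fin (fun r => \bigcup_(u in component (step G d) (r 0)) [set rk (r 0) u]) by [].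
  apply: (@fin_bigcup _ (fun u r => [set rk (r 0) u])).
    (* The target block is the ball of radius 0. *)
    by apply: (@fin_nball _ _ G d hG 0); apply: rf_var.
  by apply: fin_set1; apply: rk1.
Qed.

Variables (wit : asi_witness G d (part G d)) (lt : {x | D x} -> {x | D x} -> Prop).
Hypothesis lin : linear_order lt.
Hypothesis ltE : forall x y, lt x y <-> sval x < sval y.

Local Notation ball x := (block_ball G d (part G d) n (block G d (part G d) x)).

Definition label (x : {x | D x}) (y : {y | ball x y}) : HF := rk (sval x) (sval (sval y)).

Lemma mem_nball x (y : {y | ball x y}) : W (sval x) (sval (sval y)).
Proof. by rewrite nball_block_ball; exists (sval y) => //; apply: (svalP y). Qed.

Lemma nball_mem x u : W (sval x) u -> exists y : {y | ball x y}, sval (sval y) = u.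
Proof. by rewrite nball_block_ball => -[y xy <-]; exists (exist _ y xy). Qed.

Lemma label_canonical x : canonical_labelling (local_input wit lin n x) (@label x).
Proof.
split; last first.
  move=> y z; rewrite /= ltE; apply: rank_mono; exact: mem_nball.
(* Past every element of the ball, the rank is the number of its vertices. *)
have [b Wb] : exists b, forall u, W (sval x) u -> u < b.
  have [/(_ (fun=> sval x)) fW _] := fin_nball d hG n (rf_var 0).
  by exists (hf_set (W (sval x))) => u Wu; apply: hf_mem_lt; apply/hf_mem_set.
exists (rk (sval x) b); split.
- by move=> y _ /=; apply: rank_ltn; [apply: mem_nball|apply/Wb/mem_nball].
- by move=> y z _ _ e; apply/sval_inj/sval_inj; apply: rank_inj e; apply: mem_nball.
- move=> k /= /rank_surj [u /nball_mem [y yu] e]; exists y => //.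
  by rewrite /label yu.
Qed.

Lemma input_code_nat x : input_code (local_input wit lin n x) (@label x) = nat_code (sval x).
Proof.
rewrite /input_code /nat_code; cbv zeta.
congr hf_list; congr [:: _; _; _; _; _; _].
- congr hf_set; apply/seteqP; split=> z.
    by case=> y _ <-; exists (sval (sval y)) => //; apply: mem_nball.
  by case=> u /nball_mem [y <-] ->; exists y.
- congr hf_set; apply/seteqP; split=> z.
    case=> u [v [uv ->]]; exists (sval (sval u)); first exact: mem_nball.
    exists (sval (sval v)); first exact: mem_nball.
    by split=> //; exists (sval u), (sval v).
  case=> _ /nball_mem [u <-] [_ /nball_mem [v <-] [[a [b [ab /sval_inj ea /sval_inj eb]]] ->]].
  by subst a b; exists u, v.
- congr hf_list; apply: eq_map => i; congr hf_set; apply/seteqP; split=> z.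
    case=> t [st ->]; exists (map (sval \o sval) t); split.
    + by rewrite size_map size_tuple.
    + move=> y /(tnthP (map_tuple (sval \o sval) t)) [j ->]; rewrite tnth_map.
      exact: mem_nball.
    + split; first by exists (map_tuple sval t); split=> //=; rewrite map_comp.
      by rewrite -map_comp.
  case=> s [ss sW [[u [su es]] ->]].
  (* A tuple of numbers becomes a tuple of vertices of the local input only once each entry is known
     to lie in the ball. *)
  have uW j : ball x (tnth u j).
    have : W (sval x) (sval (tnth u j)).
      apply: sW; rewrite es -tnth_map; exact: mem_tnth.
    by rewrite nball_block_ball => -[y xy /sval_inj <-].
  pose t := [tuple exist _ (tnth u j) (uW j) | j < arity i].
  have tu : map_tuple sval t = u.
    by apply: eq_from_tnth => j; rewrite tnth_map tnth_mktuple.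
  exists t; split; first by change (srel G (map_tuple sval t)); rewrite tu.
  have ut : u = map sval t :> seq _ by rewrite -[in LHS]tu.
  by rewrite es ut /label -!map_comp.
- congr hf_set; apply/seteqP; split=> z.
    case=> u [v [/ltE uv ->]]; exists (sval (sval u)); first exact: mem_nball.
    by exists (sval (sval v)); first exact: mem_nball.
  case=> _ /nball_mem [u <-] [_ /nball_mem [v <-] [uv ->]].
  by exists u, v; split=> //; apply/ltE.
- congr hf_list; apply: eq_map => i; congr hf_set; apply/seteqP; split=> z.
    by case=> u [<- ->]; exists (sval (sval u)); first exact: mem_nball.
  by case=> _ /nball_mem [u <-] [<- ->]; exists u.
- congr hf_set; rewrite block_component; apply/seteqP; split=> z.
    by case=> u [xu ->]; exists (sval (sval u)) => //; exists (sval u).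
  case=> _ [y xy <-] ->.
  have By : ball x y.
    by exists (block G d (part G d) x); split=> //; [exists x|exists 0 => //; apply: walk0].
  by exists (exist _ y By).
Qed.

End Coding.

(** * Computability of the resulting coloring *)

(** Labels and pairs are injective, so the color of [x] can be found by testing candidates [v] for
    membership, without decoding the output. *)
Lemma mem_output_code L s (A : asi_algorithm L s) V (I : asi_input L s V) (e : V -> HF)
    (x : {x | in_target I x}) v : canonical_labelling I e ->
  hf_mem (hf_pair (e (sval x)) v) (output_code A I e) <-> v = run A x.
Proof.
move=> [[n [_ injV _]] _]; rewrite /output_code.
rewrite hf_mem_set; last first.
  by apply: finite_image; apply: finite_setT_sig; apply: sub_finite_set (in_finite I).
split=> [[y _ /hf_pair_inj [exy <-]]|->]; last by exists x.
by congr run; apply/sval_inj/injV; rewrite ?inE.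
Qed.

Lemma sval_linear_order (D : set nat) :
  linear_order (fun x y : {x | D x} => sval x < sval y).
Proof.
apply: (@linear_order_sig nat (fun x y => x < y)).
split=> [x|x y z|x y]; [by rewrite ltnn|exact: ltn_trans|].
by case: (ltngtP x y) => [h|h|->]; [apply: Or31|apply: Or33|apply: Or32].
Qed.

Lemma computable_asi_coloring L (A : asi_algorithm L 1) (D : set HF)
    (G : sgraph L {x | D x}) (d n : nat) (wit : asi_witness G d (part G d)) :
  computable_algorithm A -> highly_computable G ->
  computable_coloring (asi_coloring A wit (@sval_linear_order D) n).
Proof.
move=> [F [rF FA]] hG.
pose c := asi_coloring A wit (@sval_linear_order D) n.
(* [computable_coloring] asks for a total function; the default 0 keeps its graph semidecidable
   because [D] is decidable. *)
pose f a := if pselect (D a) is left Da then c (exist _ a Da) else 0.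
exists f; split; last first.
  move=> x; rewrite /f; case: pselect => [Dx|/(_ (svalP x)) //].
  by congr c; apply: sval_inj.
apply: rf_computable_fun.
apply: (@rf_graph _ (fun v r => (~ D (r 0) /\ v = 0) \/ (D (r 0) /\
  hf_mem (hf_pair (rank (nball G d n (r 0)) (r 0)) v) (F (nat_code G d n (r 0)))))).
  apply: re_or; apply: re_and.
  - by have [_] := dec_dom hG (rf_var 1).
  - by apply: re_eq (rf_const 0); apply: rf_var.
  - by have [] := dec_dom hG (rf_var 1).
  - have H1 : rf (fun r => hf_pair (rank (nball G d n (r 1)) (r 1)) (r 0)).
      by apply: rf_hf_pair (rf_var 0); apply: rf_rk => //; apply: rf_var.
    have H2 : rf (fun r => F (nat_code G d n (r 1))).
      apply: (@rf_app (fun x _ => F x)); first exact: computable_fun_rf.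
      exact: (rf_shift (rf_nat_code d n hG)).
    by have [] := dec_mem H1 H2.
move=> v r; rewrite /f; case: pselect => [Dx|nD]; last first.
  by split=> [[[]|[]]|->]; [| |left].
set x := exist _ _ Dx.
have lab := label_canonical n hG wit (@sval_linear_order D) (fun x y => iff_refl _).
have := FA _ _ _ (lab x).
rewrite (input_code_nat n wit (@sval_linear_order D) (fun x y => iff_refl _)) => ->.
pose I := local_input wit (@sval_linear_order D) n x.
pose x0 := exist (in_target I) (exist _ x (block_ball_refl G d (part G d) n x))
  (block_refl G d (part G d) x).
apply: iff_trans (@mem_output_code _ _ A _ I _ x0 v (lab x)).
by split=> [[[]//|[]//]|]; right.
Qed.

Theorem theorem2p13 (L : language) (P : coloring_problem L) :
  ASIc 1 P -> HComp P.
Proof.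
move=> [A [cA [n [d H]]]] D G GG hG.
(* The partition is built for the scale [d] that the algorithm demands; the construction works for
   every scale. *)
have wit := part_witness d hG.
exists (asi_coloring A wit (@sval_linear_order D) n); split; first exact: H.
exact: computable_asi_coloring.
Qed.
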